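(* For integers $k\ge2$ and $n\ge0$ let \[ J_k(n)=\sum_{r=1}^{k-1}2^k\int_{[0,1]^k}\frac{(1-u_1^4\cdots u_r^4)^n(1-u_{r+1}^4\cdots u_k^4)^n}{(1-u_1^2\cdots u_k^2)^{2n+1}}\,du_1\cdots du_k , \] set $J_0(n)=0$, $J_1(n)=\frac{2^nn!}{(2n+1)!!}$, and let $w_k(z)=\sum_{n\ge0}J_k(n)z^n$ for $k\ge0$. Then for every $k\ge2$, \[ \left\{z(1-z)^2\frac{d^2}{dz^2}+(1-z)(1-3z)\frac{d}{dz}+z-\frac34\right\}w_k(z)=w_{k-2}(z). \] *)

(* Defs.v *)
From HB Require Import structures.
From mathcomp Require Import all_boot all_order all_algebra.
From mathcomp Require Import complex.
From mathcomp Require Import all_classical all_reals all_analysis.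

Set Implicit Arguments.
Unset Strict Implicit.
Unset Printing Implicit Defensive.

Import Order.TTheory GRing.Theory Num.Theory.
Import numFieldNormedType.Exports.

Local Open Scope classical_set_scope.
Local Open Scope ring_scope.

Notation tupleR k R := (k.-tuple (measurableTypeR R)).

Definition pair_cons (R : realType) (k : nat)
  (p : measurableTypeR R * tupleR k R) : tupleR k.+1 R :=
  [tuple of p.1 :: p.2].

Definition tuple_uncons (R : realType) (k : nat)
  (u : tupleR k.+1 R) : measurableTypeR R * tupleR k R :=
  (thead u, [tuple of behead u]).

Section lebesgue_cons.
Variables (R : realType) (k : nat).

Lemma pair_consK : cancel (@pair_cons R k) (@tuple_uncons R k).
Proof. by move=> [x t]; congr pair; apply: val_inj. Qed.

Lemma tuple_unconsK : cancel (@tuple_uncons R k) (@pair_cons R k).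
Proof. by move=> u; rewrite [RHS]tuple_eta; apply: val_inj. Qed.

Lemma measurable_pair_cons : measurable_fun setT (@pair_cons R k).
Proof. exact: measurable_cons. Qed.

Lemma measurable_tuple_uncons : measurable_fun setT (@tuple_uncons R k).
Proof.
apply/measurable_fun_pairP; split; first exact: measurable_tnth.
exact: measurable_behead.
Qed.

Variable mu : {sigma_finite_measure set (tupleR k R) -> \bar R}.

Definition lebesgue_cons : set (tupleR k.+1 R) -> \bar R :=
  pushforward (@lebesgue_measure R \x mu)%E (@pair_cons R k).

Let lebesgue_cons0 : lebesgue_cons set0 = 0%E.
Proof. by rewrite /lebesgue_cons /pushforward preimage_set0 measure0. Qed.

Let lebesgue_cons_ge0 A : (0 <= lebesgue_cons A)%E.
Proof. by rewrite /lebesgue_cons /pushforward measure_ge0. Qed.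

Let lebesgue_cons_sigma_additive : semi_sigma_additive lebesgue_cons.
Proof.
by apply: measure_semi_sigma_additive => //; exact: measurable_pair_cons.
Qed.

HB.instance Definition _ := isMeasure.Build _ _ _ lebesgue_cons
  lebesgue_cons0 lebesgue_cons_ge0 lebesgue_cons_sigma_additive.

Let lebesgue_cons_sigma_finite : sigma_finite setT lebesgue_cons.
Proof.
have /sigma_finiteP[F [TF ndF Foo]] := sigma_finiteT (@lebesgue_measure R).
have /sigma_finiteP[G [TG ndG Goo]] := sigma_finiteT mu.
exists (fun i => @tuple_uncons R k @^-1` (F i `*` G i)).
  rewrite -preimage_bigcup (_ : \bigcup_i _ = setT) ?preimage_setT//.
  apply/seteqP; split=> // -[x t] _.
  have [i _ Fix] : (\bigcup_i F i) x by rewrite -TF.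
  have [j _ Gjt] : (\bigcup_i G i) t by rewrite -TG.
  exists (maxn i j) => //; split => /=.
    by move: x Fix; exact/subsetPset/ndF/leq_maxl.
  by move: t Gjt; exact/subsetPset/ndG/leq_maxr.
move=> i; have [mF muF] := Foo i; have [mG muG] := Goo i; split.
  rewrite -[X in measurable X]setTI.
  by apply: measurable_tuple_uncons => //; exact: measurableX.
rewrite /lebesgue_cons /pushforward -comp_preimage.
rewrite (_ : _ \o _ = id) ?preimage_id; last exact/funext/pair_consK.
by rewrite product_measure1E// lte_mul_pinfty// ge0_fin_numE.
Qed.

HB.instance Definition _ := Measure_isSigmaFinite.Build _ _ _ lebesgue_cons
  lebesgue_cons_sigma_finite.

End lebesgue_cons.

(* Lebesgue measure on R^k, as the k-fold product of the Lebesgue measure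
   on R; it is characterized by lebesgue_tuple_box below. *)
Fixpoint lebesgue_tuple (R : realType) (k : nat) :
    {sigma_finite_measure set (tupleR k R) -> \bar R} :=
  if k is k'.+1 then lebesgue_cons (lebesgue_tuple R k')
  else \d_([tuple] : tupleR 0 R).

Lemma lebesgue_tuple_box (R : realType) (k : nat)
    (A : 'I_k -> set (measurableTypeR R)) : (forall i, measurable (A i)) ->
  lebesgue_tuple R k [set u | forall i, A i (tnth u i)] =
  (\prod_(i < k) lebesgue_measure (A i))%E.
Proof.
elim: k A => [|k IH] A mA.
  rewrite big_ord0 /= diracE mem_set//= => -[].
  by [].
rewrite big_ord_recl -IH//= /lebesgue_cons /pushforward.
rewrite -product_measure1E//.
  congr (_ _); apply/seteqP; split => [[x t]/= h|[x t]/= [h0 h] i].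
    split; first by have := h ord0.
    by move=> i; have := h (lift ord0 i); rewrite tnthS.
  by case: (unliftP ord0 i) => [j ->|->//]; rewrite tnthS; exact: h.
rewrite (_ : mkset _ =
    \bigcap_(i in [set: 'I_k]) ((fun u : tupleR k R => tnth u i) @^-1` A (lift ord0 i))).
  apply: fin_bigcap_measurable => // i _.
  by rewrite -[X in measurable X]setTI; exact: measurable_tnth.
by apply/seteqP; split => u h i => [_|]; exact: h.
Qed.

Definition unit_cube (R : realType) (k : nat) : set (tupleR k R) :=
  [set u | forall i, 0 <= tnth u i <= 1].

Arguments unit_cube : clear implicits.

(* u_1, ..., u_k is stored as tnth u 0, ..., tnth u (k - 1).  The integrand
   takes the value 0 (division by 0) at the corner u = (1, ..., 1). *)
Definition J_integrand (R : realType) (k n r : nat) (u : tupleR k R) : R :=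
  (1 - \prod_(i < k | (i < r)%N) tnth u i ^+ 4) ^+ n *
  (1 - \prod_(i < k | (r <= i)%N) tnth u i ^+ 4) ^+ n /
  (1 - \prod_(i < k) tnth u i ^+ 2) ^+ (2 * n + 1).

(* (2n + 1)!! *)
Definition odd_dfact (n : nat) : nat := \prod_(i < n.+1) (2 * i + 1).

Definition J (R : realType) (k n : nat) : R :=
  match k with
  | 0 => 0
  | 1 => (2 ^ n * n`!)%:R / (odd_dfact n)%:R
  | _ => \sum_(1 <= r < k)
           2 ^+ k * \int[lebesgue_tuple R k]_(u in unit_cube R k) J_integrand n r u
  end.

(* R[i] as a numFieldType, which gives it the topology of the modulus. *)
Definition Cplx (R : realType) : numFieldType := complex R.

Definition RtoC (R : realType) (x : R) : Cplx R := (x%:C)%C.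

Definition w_term (R : realType) (k : nat) (z : Cplx R) (n : nat) : Cplx R :=
  RtoC (J R k n) * z ^+ n.

Arguments w_term : clear implicits.

Definition w (R : realType) (k : nat) (z : Cplx R) : Cplx R :=
  limn (series (w_term R k z)).

Arguments w : clear implicits.

(* Main.v *)
Require Import Defs.
From HB Require Import structures.
From mathcomp Require Import all_boot all_order all_algebra.
From mathcomp Require Import complex.
From mathcomp Require Import all_classical all_reals all_analysis.
From mathcomp Require Import measurable_realfun ring lra.
Import Order.TTheory GRing.Theory Num.Theory.
Import numFieldNormedType.Exports.
Local Open Scope classical_set_scope.
Local Open Scope ring_scope.
Set Implicit Arguments.
Unset Strict Implicit.
Unset Printing Implicit Defensive.

(* The integrand of [J_k(n)] only depends on the products [x] and [y] of the first
   [r] and of the last [k - r] variables, whose densities are powers of logarithms;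
   summing over [r] with the binomial theorem leaves the single weight
   [(- log (x y))^(k-2) / (k-2)!].  At fixed [p = x y], the substitution
   [fiber_chart] turns the remaining integral over [x] into one with fixed bounds:
     [J_k(n) = 2^(k-1) int_0^1 (- log p)^(k-2) / (k-2)!
        int_{-1}^1 (1 - y^2)^n (4 p^2 + (1 - p^2)^2 y^2)^(-1/2) dy dp].
   Put [G = p (4 p^2 + (1 - p^2)^2 y^2)^(-1/2)].  Up to an exact [y]-derivative,
   [(1 - y^2)^n (p d/dp)^2 G / 4] is the second order difference operator [apery_rec]
   in [n] applied to [(1 - y^2)^n G].  Two integrations by parts in [log p] lower [k]
   by two and give
     [(n+1)^2 J_k(n+1) - (2n^2 + 2n + 3/4) J_k(n) + n^2 J_k(n-1) = J_{k-2}(n)],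
   the boundary term at [p = 1] producing [J_1(n)] when [k = 3].  Since
   [J_k(n) <= J_k(0)], the series converge on the unit disk and the recurrence is
   the differential equation read on coefficients. *)

(** * Power series and differential equations *)

Section geometric_bounds.
Context {K : numFieldType}.
Implicit Types t : K.

Lemma geometric_sum_le t n : 0 <= t < 1 -> \sum_(0 <= i < n) t ^+ i <= (1 - t)^-1.
Proof.
move=> /andP[t0 t1]; have := congr1 (@^~ n) (geometric_seriesE 1 (negbT (lt_eqF t1))).
rewrite /series /geometric/=; under eq_bigr do rewrite mul1r.
move=> ->; rewrite ler_piMl ?invr_ge0 ?subr_ge0 ?(ltW t1)//.
by rewrite mul1r gerBl exprn_ge0.
Qed.

Lemma natrM_exprn_le t n : 0 <= t < 1 -> n%:R * t ^+ n <= (1 - t)^-1.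
Proof.
move=> t01; apply: le_trans (geometric_sum_le n t01); have /andP[t0 t1] := t01.
rewrite mulr_natl -[X in _ *+ X]subn0 -sumr_const_nat.
by apply: ler_sum_nat => i /andP[_ /ltnW]; apply: ler_wiXn2l => //; exact: ltW.
Qed.

End geometric_bounds.

(* The library's [pseries] only accepts real coefficients. *)
Section power_series.
Context {K : numFieldType}.
Implicit Types (a b : nat -> K) (r z h l : K).

Definition power_series a z : nat -> K := series (fun n => a n * z ^+ n).

Definition diff_coef a n : K := n.+1%:R * a n.+1.

Definition shift_coef a n : K := if n is m.+1 then a m else 0.

Lemma power_series_cvgD a b z l l' :
  power_series a z @ \oo --> l -> power_series b z @ \oo --> l' ->
  power_series (fun n => a n + b n) z @ \oo --> l + l'.
Proof.
move=> al bl; rewrite [X in X @ _](_ : _ = power_series a z \+ power_series b z).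
  exact: cvgD.
apply/funext => n; rewrite /power_series /series/= -big_split/=.
by apply: eq_bigr => i _; rewrite mulrDl.
Qed.

Lemma power_series_cvgZ (k : K) a z l :
  power_series a z @ \oo --> l -> power_series (fun n => k * a n) z @ \oo --> k * l.
Proof.
move=> al; rewrite [X in X @ _](_ : _ = (fun n => k * power_series a z n)).
  exact: cvgMr.
apply/funext => n; rewrite /power_series /series/= mulr_sumr.
by apply: eq_bigr => i _; rewrite mulrA.
Qed.

Lemma power_series_cvg_shift a z l :
  power_series a z @ \oo --> l -> power_series (shift_coef a) z @ \oo --> z * l.
Proof.
move=> al; rewrite -(cvg_shiftS (power_series _ z)).
rewrite [X in X @ _](_ : _ = (fun n => z * power_series a z n)); first exact: cvgMr.
apply/funext => n; rewrite /power_series /series/= big_nat_recl//= mul0r add0r mulr_sumr.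
by apply: eq_bigr => i _; rewrite exprS mulrCA.
Qed.

Lemma power_series_diff_coefE a z n :
  power_series (diff_coef a) z n = \sum_(0 <= i < n.+1) i%:R * a i * z ^+ i.-1.
Proof. by rewrite [RHS]big_nat_recl//= !mul0r add0r. Qed.

Definition radius_ge1 a : Prop :=
  forall r, 0 < r < 1 -> exists C, forall n, `|a n| * r ^+ n <= C.

Lemma bounded_radius_ge1 a (M : K) : (forall n, `|a n| <= M) -> radius_ge1 a.
Proof.
move=> aM r /andP[/ltW r0 /ltW r1]; exists M => n; apply: le_trans (aM n).
by rewrite ler_piMr// exprn_ile1.
Qed.

Lemma radius_ge1_geometric a r : radius_ge1 a -> 0 < r < 1 ->
  exists C t : K, [/\ 0 <= C, 0 <= t < 1 & forall n, `|a n| * r ^+ n <= C * t ^+ n].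
Proof.
move=> a1 /andP[r0 r1]; have [rs s1] := midf_lt r1; set s := (r + 1) / 2 in rs s1.
have s0 : 0 < s := lt_trans r0 rs.
have [|C aC] := a1 s; first by rewrite s0.
exists C, (r / s); split=> [||n].
- by apply: le_trans (aC 0%N); rewrite mulr_ge0.
- by rewrite divr_ge0 ?ltW//= ltr_pdivrMr// mul1r.
- by rewrite expr_div_n mulrA ler_pdivlMr ?exprn_gt0// mulrAC ler_pM2r ?exprn_gt0.
Qed.

Lemma radius_ge1_natrM a : radius_ge1 a -> radius_ge1 (fun n => n%:R * a n).
Proof.
move=> a1 r /(radius_ge1_geometric a1)[C [t [C0 t01 aC]]].
exists (C * (1 - t)^-1) => n; rewrite normrM normr_nat -mulrA.
apply: le_trans (ler_wpM2l (ler0n _ n) (aC n)) _.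
by rewrite mulrCA ler_wpM2l// natrM_exprn_le.
Qed.

Lemma radius_ge1_diff_coef a : radius_ge1 a -> radius_ge1 (diff_coef a).
Proof.
move=> /radius_ge1_natrM a1 r r01; have [C aC] := a1 r r01; exists (C / r) => n.
by have /andP[r0 _] := r01; rewrite ler_pdivlMr// -mulrA -exprSr aC.
Qed.

Lemma radius_ge1_sum_le a r : radius_ge1 a -> 0 < r < 1 ->
  exists B, forall m, \sum_(0 <= n < m) `|a n| * r ^+ n <= B.
Proof.
move=> a1 /(radius_ge1_geometric a1)[C [t [C0 t01 aC]]].
exists (C * (1 - t)^-1) => m.
apply: (@le_trans _ _ (\sum_(0 <= n < m) C * t ^+ n)); first exact: ler_sum.
by rewrite -big_distrr/= ler_wpM2l// geometric_sum_le.
Qed.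

Lemma radius_ge1_disk_sum_le a z : radius_ge1 a -> `|z| < 1 ->
  exists B, forall m, \sum_(0 <= n < m) `|a n * z ^+ n| <= B.
Proof.
move=> a1 z1; have [zr r1] := midf_lt z1; set r := (_ / 2) in zr r1.
have [|B aB] := radius_ge1_sum_le (r := r) a1; first by rewrite (le_lt_trans _ zr).
exists B => m; apply: le_trans (aB m); apply: ler_sum => n _.
by rewrite normrM normrX ler_wpM2l// lerXn2r ?nnegrE// ltW// (le_lt_trans _ zr).
Qed.

(* Multiplying by [r ^+ 2] avoids the truncated exponent [n - 2]. *)
Lemma exprn_taylor1_le (z h r : K) n : `|z| <= r -> `|z + h| <= r ->
  `|(z + h) ^+ n - z ^+ n - n%:R * z ^+ n.-1 * h| * r ^+ 2 <=
  n%:R ^+ 2 * r ^+ n * `|h| ^+ 2.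
Proof.
move=> zr zhr; have r0 : 0 <= r by exact: le_trans zr.
elim: n => [|n ih]; first by rewrite !expr0 subrr !mul0r subr0 normr0 expr0n/= !mul0r.
set e := (X in `|X| * _ <= _ -> _) in ih *.
have -> : (z + h) ^+ n.+1 - z ^+ n.+1 - n.+1%:R * z ^+ n * h =
    (z + h) * e + n%:R * z ^+ n.-1 * h ^+ 2.
  rewrite /e; case: n {e} => [|n] /=; first by rewrite !expr0 !expr1; ring.
  by rewrite -[n.+2%:R]natr1 !exprS; ring.
have quadratic_le : `|n%:R * z ^+ n.-1 * h ^+ 2| * r ^+ 2 <= n%:R * r ^+ n.+1 * `|h| ^+ 2.
  case: n {e} => [|n]; first by rewrite !mul0r normr0 mul0r.
  rewrite [leRHS](_ : _ = n.+1%:R * r ^+ n * `|h| ^+ 2 * r ^+ 2); last first.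
    by rewrite -[n.+2]addn2 exprD; ring.
  rewrite ler_wpM2r ?exprn_ge0// normrM normrX ler_wpM2r ?exprn_ge0//.
  by rewrite normrM normr_nat normrX ler_wpM2l// lerXn2r ?nnegrE.
move=> ih; apply: le_trans (ler_wpM2r (exprn_ge0 2 r0) (ler_normD _ _)) _.
rewrite mulrDl normrM -mulrA.
apply: le_trans (lerD (ler_pM _ _ zhr ih) quadratic_le) _; rewrite ?mulr_ge0 ?exprn_ge0//.
have -> : r * (n%:R ^+ 2 * r ^+ n * `|h| ^+ 2) + n%:R * r ^+ n.+1 * `|h| ^+ 2 =
    (n%:R ^+ 2 + n%:R) * (r ^+ n.+1 * `|h| ^+ 2) by rewrite [r ^+ n.+1]exprS; ring.
rewrite -[X in _ <= X]mulrA; apply: ler_wpM2r; first by rewrite mulr_ge0 ?exprn_ge0.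
by rewrite -natr1 sqrrD1 -addrA lerD2l mulr2n -addrA lerDl addr_ge0.
Qed.

Lemma is_derive_quadratic (f : K -> K) z l (B d : K) : 0 <= B -> 0 < d ->
  (forall h, `|h| < d -> `|f (z + h) - f z - l * h| <= B * `|h| ^+ 2) ->
  is_derive z 1 f l.
Proof.
move=> B0 d0 fl.
suff quotient_cvg : (fun h => h^-1 *: (f (h *: 1 + z) - f z)) @ 0^' --> l.
  by apply: DeriveDef; [apply/cvg_ex; exists l|exact: cvg_lim].
apply/cvgrPdist_lt => e e0.
have B1 : 0 < B + 1 by rewrite ltr_wpDl.
near=> h; have h0 : h != 0 by near: h; exact: nbhs_dnbhs_neq.
have hd : `|h| < d by near: h; exact: dnbhs0_lt.
have he : `|h| < e / (B + 1) by near: h; apply: dnbhs0_lt; exact: divr_gt0.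
have nh0 : 0 < `|h| by rewrite normr_gt0.
rewrite -(ltr_pM2r nh0) -normrM [h *: 1]mulr1 (addrC h z) mulrBl mulrAC mulVf// mul1r.
rewrite distrC; apply: le_lt_trans (fl _ hd) _.
rewrite expr2 mulrA ltr_pM2r//; move: he; rewrite ltr_pdivlMr// mulrC; apply: le_lt_trans.
by rewrite ler_wpM2r// lerDl.
Unshelve. all: by end_near. Qed.

Lemma cvg_norm_le (u : nat -> K) l (B : K) :
  u @ \oo --> l -> (forall n, `|u n| <= B) -> `|l| <= B.
Proof.
move=> /cvgrPdist_lt ul uB; apply/ler_addgt0Pr => e /ul[n _ /(_ n (leqnn n)) lun].
by rewrite -(subrK (u n) l) addrC (le_trans (ler_normD _ _))// lerD// ltW.
Qed.

Theorem power_series_is_derive a z (f : K -> K) l : radius_ge1 a -> `|z| < 1 ->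
  (forall x, `|x| < 1 -> power_series a x @ \oo --> f x) ->
  power_series (diff_coef a) z @ \oo --> l -> is_derive z 1 f l.
Proof.
move=> a1 z1 af al; have [zr r1] := midf_lt z1; set r := (_ / 2) in zr r1.
have r0 : 0 < r by exact: le_lt_trans zr.
have [|B aB] := radius_ge1_sum_le (r := r) (radius_ge1_natrM (radius_ge1_natrM a1)).
  by rewrite r0.
have B0 : 0 <= B by apply: le_trans (aB 0%N); rewrite big_geq.
apply: (@is_derive_quadratic f z l (B / r ^+ 2) (r - `|z|)).
- by rewrite divr_ge0 ?exprn_ge0// ltW.
- by rewrite subr_gt0.
move=> h hr; have zhr : `|z + h| < r.
  by apply: le_lt_trans (ler_normD _ _) _; rewrite -ltrBrDl.
apply: (@cvg_norm_le (fun m => power_series a (z + h) m.+1 - power_series a z m.+1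
    - power_series (diff_coef a) z m * h)).
  apply: cvgB; last exact: cvgMl.
  apply: cvgB; rewrite (cvg_shiftS (power_series _ _)); apply: af => //.
  exact: lt_trans zhr r1.
move=> m; rewrite power_series_diff_coefE /power_series /series/= mulr_suml -!sumrB.
rewrite mulrAC ler_pdivlMr ?exprn_gt0//.
apply: le_trans (ler_wpM2r (exprn_ge0 2 (normr_ge0 h)) (aB m.+1)).
apply: le_trans (ler_wpM2r (exprn_ge0 2 (ltW r0)) (ler_norm_sum _ _ _)) _.
rewrite !mulr_suml; apply: ler_sum => n _.
have -> : a n * (z + h) ^+ n - a n * z ^+ n - n%:R * a n * z ^+ n.-1 * h =
    a n * ((z + h) ^+ n - z ^+ n - n%:R * z ^+ n.-1 * h) by ring.
rewrite normrM -[_ * r ^+ 2]mulrA.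
apply: le_trans (ler_wpM2l _ (exprn_taylor1_le n (ltW zr) (ltW zhr))) _ => //.
rewrite !normrM !normr_nat.
by rewrite [leRHS](_ : _ = `|a n| * (n%:R ^+ 2 * r ^+ n * `|h| ^+ 2))//; ring.
Qed.
End power_series.

Section recurrence_to_ode.
Context {K : numFieldType}.
Implicit Types (a : nat -> K) (c z : K).

(* The coefficient of [z ^+ n] in the differential operator of the theorem applied to
   [\sum_i a i * z ^+ i]. *)
Definition apery_rec a n : K :=
  n.+1%:R ^+ 2 * a n.+1 - (2 * n%:R ^+ 2 + 2 * n%:R + 3 / 4) * a n
  + n%:R ^+ 2 * a n.-1.

Lemma apery_recZ c a n : apery_rec (fun i => c * a i) n = c * apery_rec a n.
Proof. by rewrite /apery_rec; ring. Qed.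

Lemma apery_recE a :
  let a1 := diff_coef a in let a2 := diff_coef a1 in
  apery_rec a = fun n =>
    shift_coef a2 n + -2 * shift_coef (shift_coef a2) n
    + shift_coef (shift_coef (shift_coef a2)) n + a1 n + -4 * shift_coef a1 n
    + 3 * shift_coef (shift_coef a1) n + shift_coef a n + - (3 / 4) * a n.
Proof.
move=> a1 a2; apply/funext => -[|[|[|n]]];
  rewrite /apery_rec /a2 /a1 /diff_coef /shift_coef/= -?[in n.+4%:R]natr1
    -?[in n.+3%:R]natr1 -?[in n.+2%:R]natr1 -?[in n.+1%:R]natr1; by field.
Qed.

Lemma power_series_cvg_apery_rec a z l0 l1 l2 :
  power_series a z @ \oo --> l0 ->
  power_series (diff_coef a) z @ \oo --> l1 ->
  power_series (diff_coef (diff_coef a)) z @ \oo --> l2 ->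
  power_series (apery_rec a) z @ \oo -->
    z * (1 - z) ^+ 2 * l2 + (1 - z) * (1 - 3 * z) * l1 + (z - 3 / 4) * l0.
Proof.
move=> al0 al1 al2; rewrite apery_recE.
rewrite (_ : _ + _ = z * l2 + -2 * (z * (z * l2)) + z * (z * (z * l2)) +
    l1 + -4 * (z * l1) + 3 * (z * (z * l1)) + z * l0 + - (3 / 4) * l0); last by field.
by do 7!(apply: power_series_cvgD;
  last by do ?apply: power_series_cvgZ; do ?apply: power_series_cvg_shift);
  apply: power_series_cvg_shift.
Qed.

End recurrence_to_ode.

Lemma rmorph_apery_rec (K L : numFieldType) (f : {rmorphism K -> L}) (a : nat -> K) n :
  f (apery_rec a n) = apery_rec (f \o a) n.
Proof.
by rewrite /apery_rec !(rmorph_nat, rmorphXn, fmorphV, rmorphB, rmorphM, rmorphD).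
Qed.

Section complex_power_series.
Context {R : realType}.
Implicit Types (a u : nat -> Cplx R) (z : Cplx R).

Lemma cvg_RtoC (x : nat -> R) (l : R) :
  x @ \oo --> l -> (fun n => RtoC (x n)) @ \oo --> RtoC l.
Proof.
move=> /cvgrPdist_lt xl; apply/cvgrPdist_lt => e; rewrite ltcE/= => /andP[/eqP Im0 e0].
rewrite (_ : e = RtoC (complex.Re e)); last by rewrite /RtoC; case: e Im0 {e0} => ? ? /= ->.
apply: filterS (xl _ e0) => n.
by rewrite /RtoC -rmorphB normc_def/= expr0n/= addr0 sqrtr_sqr ltcR.
Qed.

Lemma series_Re_cvg u (B : Cplx R) :
  (forall m, \sum_(0 <= n < m) `|u n| <= B) -> cvgn (series (@complex.Re R \o u)).
Proof.
move=> uB; pose v n := complex.Re `|u n|.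
have vE n : `|u n| = RtoC (v n) by [].
have v0 n : 0 <= v n by rewrite -ler0c -/(RtoC _) -vE.
apply/normed_cvg/(series_le_cvg _ v0) => [n|n|]; first exact: normr_ge0.
  by rewrite /= -lecR -/(RtoC (v n)) -vE normc_ge_Re.
apply: nondecreasing_is_cvgn.
  by apply/nondecreasing_seqP => n; rewrite /series/= big_nat_recr//= lerDl.
exists (complex.Re B) => _ [m _ <-]; have := uB m; under eq_bigr do rewrite vE.
by rewrite /series/= /RtoC -rmorph_sum lecE => /andP[].
Qed.

Lemma summable_series_cvg u (B : Cplx R) :
  (forall m, \sum_(0 <= n < m) `|u n| <= B) -> cvgn (series u).
Proof.
move=> uB; have /cvg_RtoC cvgRe := series_Re_cvg uB.
have norm_i : `|'i%C : Cplx R| = 1 by rewrite normc_def/= expr0n expr1n add0r sqrtr1.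
have uiB m : \sum_(0 <= n < m) `|u n * - 'i%C| <= B.
  by under eq_bigr do rewrite normrM normrN norm_i mulr1.
have /cvg_RtoC cvgIm := series_Re_cvg uiB.
apply: cvgP; rewrite [X in X @ _](_ : _ = (fun m => RtoC (series (@complex.Re R \o u) m)
    + 'i%C * RtoC (series (@complex.Re R \o (fun n => u n * - 'i%C)) m))).
  by apply: cvgD cvgRe _; apply: cvgMr; exact: cvgIm.
apply/funext => m; rewrite /series/= /RtoC !rmorph_sum mulr_sumr -big_split/=.
by apply: eq_bigr => n _; rewrite [LHS]complexE mulrN raddfN/= ReiNIm opprK.
Qed.

Lemma radius_ge1_cvg a z : radius_ge1 a -> `|z| < 1 -> cvgn (power_series a z).
Proof.
by move=> a1 z1; have [B] := radius_ge1_disk_sum_le a1 z1; exact: summable_series_cvg.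
Qed.

Definition power_sum a z : Cplx R := limn (power_series a z).

Lemma is_derive_power_sum a z : radius_ge1 a -> `|z| < 1 ->
  is_derive z 1 (power_sum a) (power_sum (diff_coef a) z).
Proof.
move=> a1 z1; apply: (power_series_is_derive a1 z1) => [x x1|]; first exact: radius_ge1_cvg.
by apply: radius_ge1_cvg => //; exact: radius_ge1_diff_coef.
Qed.

Lemma is_derive_derive1_power_sum a z : radius_ge1 a -> `|z| < 1 ->
  is_derive z 1 (derive1 (power_sum a)) (power_sum (diff_coef (diff_coef a)) z).
Proof.
move=> a1 z1.
apply: (@near_eq_is_derive _ _ _ (power_sum (diff_coef a))); last first.
  by apply: is_derive_power_sum => //; exact: radius_ge1_diff_coef.
have : \forall x \near z, `|x| < 1.
  exact: (@cvgr_norm_lt _ _ _ (nbhs z) _ id z cvg_id _ z1).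
by apply: filterS => x x1; rewrite derive1E; apply/esym/derive_val/is_derive_power_sum.
Qed.

Theorem power_sum_apery_rec_ode a z : radius_ge1 a -> `|z| < 1 ->
  [/\ cvgn (power_series a z),
      cvgn (power_series (apery_rec a) z),
      derivable (power_sum a) z 1,
      derivable (derive1 (power_sum a)) z 1 &
      z * (1 - z) ^+ 2 * derive1 (derive1 (power_sum a)) z
        + (1 - z) * (1 - 3 * z) * derive1 (power_sum a) z + (z - 3 / 4) * power_sum a z
      = power_sum (apery_rec a) z].
Proof.
move=> a1 z1; have da1 := radius_ge1_diff_coef a1.
have d1 := is_derive_power_sum a1 z1; have d2 := is_derive_derive1_power_sum a1 z1.
have cvg_rec := power_series_cvg_apery_rec (radius_ge1_cvg a1 z1) (radius_ge1_cvg da1 z1)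
  (radius_ge1_cvg (radius_ge1_diff_coef da1) z1).
split; first exact: radius_ge1_cvg.
- exact: cvgP cvg_rec.
- exact: (@ex_derive _ _ _ _ _ _ _ d1).
- exact: (@ex_derive _ _ _ _ _ _ _ d2).
- rewrite !derive1E (@derive_val _ _ _ _ _ _ _ d1).
  by rewrite (@derive_val _ _ _ _ _ _ _ d2); apply/esym/cvg_lim => //; exact: cvg_rec.
Qed.

End complex_power_series.

(** * Calculus on explicit formulas *)

(* The library's derivation rules act on sums and products in the ring of functions;
   the instances of this class act on explicit lambda-abstractions, so that the
   derivative of a closed formula is found by inference. *)
Section derives.
Context {R : realType}.
Implicit Types (f g : R -> R) (x d e : R).

Definition derives f x d : Prop := is_derive (x : R^o) 1 (f : R^o -> R^o) d.
Existing Class derives.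

Lemma derives_eq f x d e : derives f x d -> d = e -> derives f x e.
Proof. by move=> ? <-. Qed.

#[global] Instance derives_cst c x : derives (fun=> c) x 0.
Proof. exact: is_derive_cst. Qed.

#[global] Instance derives_id x : derives (fun y => y) x 1.
Proof. exact: is_derive_id. Qed.

#[global] Instance derivesN f x d : derives f x d -> derives (fun y => - f y) x (- d).
Proof. by move=> fd; exact: is_deriveN. Qed.

#[global] Instance derivesD f g x d e :
  derives f x d -> derives g x e -> derives (fun y => f y + g y) x (d + e).
Proof. by move=> fd ge; exact: is_deriveD. Qed.

#[global] Instance derivesM f g x d e :
  derives f x d -> derives g x e -> derives (fun y => f y * g y) x (d * g x + f x * e).
Proof.
by move=> fd ge; apply: is_derive_eq (is_deriveM fd ge) _; rewrite /GRing.scale/=; ring.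
Qed.

#[global] Instance derivesX f x d n :
  derives f x d -> derives (fun y => f y ^+ n) x (n%:R * f x ^+ n.-1 * d).
Proof.
move=> fd; elim: n => [|[|n] ih].
- by rewrite !mul0r; exact: derives_cst.
- by apply: derives_eq fd _; rewrite expr0 !mul1r.
- apply: derives_eq (derivesM fd ih) _ => /=.
  by rewrite -[n.+2%:R]natr1 !exprS; ring.
Qed.

Lemma derivesV f x d :
  f x != 0 -> derives f x d -> derives (fun y => (f y)^-1) x (- d / f x ^+ 2).
Proof.
by move=> f0 fd; apply: is_derive_eq (is_deriveV f0 fd) _; rewrite /GRing.scale/=; ring.
Qed.

Lemma derives_ln x : 0 < x -> derives (@ln R) x x^-1.
Proof. by move=> x0; exact: is_derive1_ln. Qed.

Lemma derives_invsqrt f x d : 0 < f x -> derives f x d ->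
  derives (fun y => (Num.sqrt (f y))^-1) x (- (d / 2) * (Num.sqrt (f x))^-1 ^+ 3).
Proof.
move=> f0 fd; have s0 : 0 < Num.sqrt (f x) by rewrite sqrtr_gt0.
have ds : derives (fun y => Num.sqrt (f y)) x ((2 * Num.sqrt (f x))^-1 * d).
  by have := is_derive1_sqrt f0 => ?; exact: is_derive1_comp.
apply: derives_eq (@derivesV (fun y => Num.sqrt (f y)) _ _ (lt0r_neq0 s0) ds) _.
by field; rewrite gt_eqF.
Qed.

Lemma derives_continuous f x d : derives f x d -> {for x, continuous f}.
Proof.
by move=> fd; apply/differentiable_continuous/derivable1_diffP/(@ex_derive _ _ _ _ _ _ _ fd).
Qed.

Lemma derives_derive1 f x d : derives f x d -> (f^`())%classic x = d.
Proof. by move=> fd; rewrite derive1E; exact: derive_val. Qed.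

Lemma derives_LRcontinuous f (f' : R -> R) (a b : R) : a <= b ->
  (forall x, a <= x <= b -> derives f x (f' x)) -> derivable_oo_LRcontinuous f a b.
Proof.
move=> ab df; split=> [x||].
- rewrite in_itv/= => /andP[/ltW ax /ltW xb].
  by apply: (@ex_derive _ _ _ _ _ _ _ (df x _)); rewrite ax.
- by apply/cvg_at_right_filter/(@derives_continuous _ _ (f' a))/df; rewrite lexx.
- by apply/cvg_at_left_filter/(@derives_continuous _ _ (f' b))/df; rewrite lexx andbT.
Qed.

Lemma derives_FTC2 (f F : R -> R) (a b : R) : a < b -> {in `[a, b], continuous f} ->
  (forall x, a <= x <= b -> derives F x (f x)) ->
  (\int[lebesgue_measure]_(x in `[a, b]) (f x)%:E)%E = (F b - F a)%:E.
Proof.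
move=> ab cf dF; rewrite (@continuous_FTC2 _ f F)//.
- by apply: continuous_in_subspaceT => x /set_mem; exact: cf.
- exact: derives_LRcontinuous (ltW ab) dF.
- move=> x; rewrite in_itv/= => /andP[/ltW ax /ltW xb].
  by apply/derives_derive1/dF; rewrite ax.
Qed.

Lemma derives_substitution_decreasing (F f G : R -> R) (a b : R) : a < b ->
  (forall x, a <= x <= b -> derives F x (f x)) ->
  {in `[a, b], continuous f} ->
  {in `[a, b] &, {homo F : x y /~ x < y}} ->
  {within `[F b, F a], continuous G} ->
  (\int[lebesgue_measure]_(x in `[F b, F a]) (G x)%:E =
   \int[lebesgue_measure]_(x in `[a, b]) (G (F x) * - f x)%:E)%E.
Proof.
move=> ab dF cf Fdec cG.
have dFE x : a <= x <= b -> (F^`())%classic x = f x by move=> xab; exact/derives_derive1/dF.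
have cfab x : a <= x <= b -> f @ x --> f x by move=> xab; apply: cf; rewrite in_itv.
rewrite (integration_by_substitution_decreasing (ltW ab) Fdec)//.
- apply: eq_integral => x /set_mem/=; rewrite in_itv/= => xab.
  by rewrite mulrfctE opprfctE /= dFE.
- move=> x; rewrite in_itv/= => /[dup] xab /andP[ax xb].
  rewrite /continuous_at dFE ?(ltW ax) ?(ltW xb)//.
  apply: cvg_trans (cfab x _); last by rewrite !ltW.
  apply: near_eq_cvg; near=> y; rewrite dFE//; apply/andP; split; apply/ltW; near: y.
    exact: lt_nbhsr.
  exact: lt_nbhsl.
- apply: cvgP; apply: cvg_trans (cvg_at_right_filter (cfab a _)); last by rewrite lexx ltW.
  apply: near_eq_cvg; near=> y; rewrite dFE//; apply/andP; split => //.
  by near: y; exact: nbhs_right_le.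
- apply: cvgP; apply: cvg_trans (cvg_at_left_filter (cfab b _)); last by rewrite lexx ltW.
  apply: near_eq_cvg; near=> y; rewrite dFE//; apply/andP; split => //.
  by near: y; exact: nbhs_left_ge.
- exact: derives_LRcontinuous (ltW ab) dF.
Unshelve. all: by end_near. Qed.

End derives.

(** * Iterated integrals and logarithmic densities *)

Section iterated_integrals.
Local Open Scope ereal_scope.
Context d1 d2 (T1 : measurableType d1) (T2 : measurableType d2) (R : realType).
Variables (m1 : {sigma_finite_measure set T1 -> \bar R}).
Variables (m2 : {sigma_finite_measure set T2 -> \bar R}).
Variables (A1 : set T1) (B1 : T1 -> set T2) (A2 : set T2) (B2 : T2 -> set T1).
Variables (f : T1 * T2 -> \bar R).
Let C := [set z | A1 z.1 /\ B1 z.1 z.2].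

Let integral_section1 :
  (fun x => \int[m2]_(y in B1 x) f (x, y)) \_ A1 = fubini_F m2 (f \_ C).
Proof.
apply/funext => x; rewrite /fubini_F patchE; case: ifPn => [/set_mem Ax|/negP Ax].
  rewrite [LHS]integral_mkcond; apply: eq_integral => y _.
  rewrite !patchE; case: ifPn => [/set_mem By|/negP By]; first by rewrite mem_set.
  by rewrite memNset// => -[_ /= /mem_set].
by rewrite integral0_eq// => y _; rewrite patchE memNset//= => -[/= /mem_set].
Qed.

Hypothesis AB : forall x y, (A1 x /\ B1 x y) <-> (A2 y /\ B2 y x).

Let integral_section2 :
  (fun y => \int[m1]_(x in B2 y) f (x, y)) \_ A2 = fubini_G m1 (f \_ C).
Proof.
apply/funext => y; rewrite /fubini_G patchE; case: ifPn => [/set_mem Ay|/negP Ay].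
  rewrite [LHS]integral_mkcond; apply: eq_integral => x _.
  rewrite !patchE; case: ifPn => [/set_mem Bx|/negP Bx]; first by rewrite mem_set//; exact/AB.
  by rewrite memNset// => /AB[_ /mem_set].
by rewrite integral0_eq// => x _; rewrite patchE memNset//= => /AB[/mem_set].
Qed.

Hypothesis mC : measurable C.

Lemma fubini_region : (m1 \x m2).-integrable C f ->
  \int[m1]_(x in A1) \int[m2]_(y in B1 x) f (x, y) =
  \int[m2]_(y in A2) \int[m1]_(x in B2 y) f (x, y).
Proof.
move=> /(integrable_mkcond _ mC) fC.
rewrite [LHS]integral_mkcond [RHS]integral_mkcond integral_section1 integral_section2.
exact: Fubini.
Qed.

Hypothesis mf : measurable_fun C f.
Hypothesis f0 : forall x y, A1 x -> B1 x y -> 0 <= f (x, y).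

Let mfC : measurable_fun setT (f \_ C).
Proof. exact/(measurable_restrictT f mC). Qed.

Let fC0 z : 0 <= (f \_ C) z.
Proof. by apply: erestrict_ge0 => -[x y] [/= Ax Bxy]; exact: f0. Qed.

Lemma measurable_integral_region : measurable A1 ->
  measurable_fun A1 (fun x => \int[m2]_(y in B1 x) f (x, y)).
Proof.
move=> mA1; apply/(measurable_restrictT _ mA1).
by rewrite integral_section1; exact: measurable_fun_fubini_tonelli_F.
Qed.

Lemma tonelli_region :
  \int[m1]_(x in A1) \int[m2]_(y in B1 x) f (x, y) =
  \int[m2]_(y in A2) \int[m1]_(x in B2 y) f (x, y).
Proof.
rewrite [LHS]integral_mkcond [RHS]integral_mkcond integral_section1 integral_section2.
exact: fubini_tonelli.
Qed.

Lemma integral_prod_region :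
  \int[m1 \x m2]_(z in C) f z = \int[m1]_(x in A1) \int[m2]_(y in B1 x) f (x, y).
Proof.
by rewrite [LHS]integral_mkcond [RHS]integral_mkcond integral_section1 fubini_tonelli1.
Qed.

End iterated_integrals.

Section real_measurability.
Context {R : realType} d (T : measurableType d).

Lemma measurable_funV (f : T -> R) :
  measurable_fun setT f -> measurable_fun setT (fun x => (f x)^-1).
Proof.
suff measurable_inv : measurable_fun setT (fun x : R => x^-1).
  by move=> mf; exact: measurableT_comp measurable_inv mf.
have -> : [set: R] = [set 0] `|` ~` [set 0] by rewrite setUv.
apply/measurable_funU => //; first exact: measurableC.
split; first exact: measurable_fun_set1.
apply: open_continuous_measurable_fun; first by rewrite openC; exact: closed_eq.
by move=> x; rewrite inE /= => /eqP x0; exact: inv_continuous.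
Qed.

Lemma measurable_fun_lt_set (f g : T -> R) :
  measurable_fun setT f -> measurable_fun setT g -> measurable [set x | f x < g x].
Proof.
move=> mf mg; have := measurable_fun_ltr mf mg => /(_ measurableT [set true]).
by rewrite setTI; exact.
Qed.

End real_measurability.

Ltac measurable_step := first
  [ exact: measurable_fst | exact: measurable_snd | exact: measurable_id
  | exact: measurable_cst | apply: measurable_funX | apply: measurable_funV
  | apply: measurable_funM | apply: measurable_funB | apply: measurable_funD
  | apply: measurable_funN ].

Ltac solve_measurable := repeat measurable_step.

Section lebesgue_measure_scale.
Local Open Scope ereal_scope.
Context {R : realType}.
Implicit Types (c : R) (D : set R).
Let mu := @lebesgue_measure R.

Lemma measurable_mulr c :
  measurable_fun setT ((fun x => x * c)%R : measurableTypeR R -> measurableTypeR R).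
Proof. exact: mulrr_measurable. Qed.

Lemma lebesgue_measure_scale c D : (0 < c)%R -> measurable D ->
  mu D = c%:E * mu ((fun x => x * c)%R @^-1` D).
Proof.
move=> c0 mD; have c0' : (0 <= c)%R by exact: ltW.
rewrite -[RHS]/(pushforward (mscale (NngNum c0') mu)
  ((fun x => x * c)%R : measurableTypeR R -> measurableTypeR R) D).
apply: lebesgue_measure_unique => //=; first exact: measurable_mulr.
move=> mphi _ [[a b]] _ <-; rewrite /pushforward /mscale/=.
rewrite (_ : _ @^-1` _ = `](a / c)%R, (b / c)%R]%classic); last first.
  by apply/seteqP; split => x /=; rewrite !in_itv/= ltr_pdivrMr// ler_pdivlMr.
rewrite /mu !lebesgue_measure_itv/= !lte_fin ltr_pM2r ?invr_gt0//.
by case: ifPn => _; rewrite ?mule0// -!EFinB -EFinM; congr EFin; field; rewrite gt_eqF.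
Qed.

Lemma ge0_integral_scale c D (f : R -> \bar R) : (0 < c)%R -> measurable D ->
  measurable_fun D f -> (forall x, D x -> 0 <= f x) ->
  \int[mu]_(x in D) f x = c%:E * \int[mu]_(x in (fun x => x * c)%R @^-1` D) f (x * c)%R.
Proof.
move=> c0 mD mf f0; have c0' : (0 <= c)%R by exact: ltW.
have mphi := measurable_mulr c.
have mcD : measurable ((fun x => x * c)%R @^-1` D : set (measurableTypeR R)).
  by rewrite -[X in measurable X]setTI; exact: mphi.
rewrite -[c in RHS]/((NngNum c0')%:num)%R.
rewrite -(@ge0_integral_mscale _ _ _ mu _ mcD (NngNum c0') (fun x => f (x * c)%R))//.
- rewrite -(ge0_integral_pushforward mphi (mscale (NngNum c0') mu))//=.
    by apply: eq_measure_integral => A mA _; exact: lebesgue_measure_scale.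
  by move=> x /set_mem; exact: f0.
- apply: (measurable_comp mD) => //; first by move=> _ [x Dx <-].
  by exact: measurable_funTS.
- by move=> x Dx; exact: f0.
Qed.

End lebesgue_measure_scale.

(* For [0 < k], the density of the product of [k] independent uniform variables on
   [0, 1]; the convention [log_density 0 = 0] makes [derives_log_density] hold for all [k]. *)
Definition log_density {R : realType} (k : nat) (x : R) : R :=
  if k is m.+1 then (- ln x) ^+ m / m`!%:R else 0.
Arguments log_density {R} k x : simpl never.

Section log_density.
Local Open Scope ereal_scope.
Context {R : realType}.
Implicit Types (p x y : R) (k : nat).
Let mu := @lebesgue_measure R.

Lemma log_density1 x : log_density 1 x = 1%R.
Proof. by rewrite /log_density expr0 fact0 divr1. Qed.

Lemma log_density_ge0 k x : (x <= 1)%R -> (0 <= log_density k x)%R.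
Proof. by case: k => // k x1; rewrite /log_density divr_ge0// exprn_ge0// oppr_ge0 ln_le0. Qed.

Lemma measurable_log_density d (T : measurableType d) (f : T -> R) k :
  measurable_fun setT f -> measurable_fun setT (fun z => log_density k (f z)).
Proof.
move=> mf; case: k => [|k]; first exact: measurable_cst.
by solve_measurable; exact: measurableT_comp (@measurable_ln R) mf.
Qed.

Lemma derives_log_density k x : (0 < x)%R ->
  derives (log_density k) x (- (log_density k.-1 x / x))%R.
Proof.
move=> x0; have dln := derives_ln x0; case: k => [|[|k]].
- by rewrite mul0r oppr0; exact: derives_cst.
- rewrite mul0r oppr0 (_ : log_density 1 = fun=> 1%R); first exact: derives_cst.
  exact/funext/log_density1.
- rewrite /log_density; apply: derives_eq => /=; rewrite factS natrM; field.
  by rewrite !pnatr_eq0 -lt0n fact_gt0 /= gt_eqF// addrC natr1 pnatr_eq0.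
Qed.

Lemma continuous_log_density k x : (0 < x)%R -> {for x, continuous (log_density k)}.
Proof. by move=> /(derives_log_density k); exact: derives_continuous. Qed.

Lemma integral_log_density_div k p : (0 < p < 1)%R ->
  \int[mu]_(y in `]p, 1%R[) (y^-1 * log_density k.+1 y)%:E = (log_density k.+2 p)%:E.
Proof.
move=> /andP[p0 p1].
have m_div : measurable_fun setT (fun y => (y^-1 * log_density k.+1 y)%R).
  by apply: measurable_funM; [solve_measurable|exact: measurable_log_density].
rewrite -(@integral_itv_bndoo _ p 1 _ true false); last exact/measurable_funTS/measurable_EFinP.
have pos y : (p <= y <= 1 -> 0 < y)%R by move=> /andP[py _]; exact: lt_le_trans py.
have cont : {in `[p, 1%R], continuous (fun y => (y^-1 * log_density k.+1 y)%R)}.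
  move=> y; rewrite in_itv/= => /pos y0; have dl := derives_log_density k.+1 y0.
  have dV := @derivesV R (fun y => y) y 1 (lt0r_neq0 y0) _.
  exact: derives_continuous.
have dlog y : (p <= y <= 1)%R ->
    derives (fun y => - log_density k.+2 y)%R y (y^-1 * log_density k.+1 y)%R.
  move=> /pos y0; have dl := derives_log_density k.+2 y0.
  by apply: derives_eq; rewrite opprK mulrC.
rewrite (derives_FTC2 p1 cont dlog).
by rewrite {1}/log_density ln1 oppr0 expr0n/= mul0r oppr0 sub0r opprK.
Qed.

Lemma measurable_unit_square :
  measurable [set z : R * R | `]0%R, 1%R[%classic z.1 /\ `]0%R, 1%R[%classic z.2].
Proof. exact: (@measurableX _ _ (measurableTypeR R) (measurableTypeR R)). Qed.

Lemma measurable_triangle :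
  measurable [set z : R * R | `]0%R, 1%R[%classic z.1 /\ `]0%R, z.1[%classic z.2].
Proof.
rewrite (_ : mkset _ = [set z | (0 < z.2)%R] `&` [set z | (z.2 < z.1)%R] `&`
    [set z | (z.1 < 1)%R]).
  by do ?apply: measurableI; apply: measurable_fun_lt_set; solve_measurable.
apply/seteqP; split=> [[x y]|[x y]] /=; rewrite !in_itv/=.
  by move=> [/andP[? ?] /andP[? ?]]; repeat split.
by move=> [[y0 yx] x1]; rewrite y0 yx x1 (lt_trans y0 yx).
Qed.

Lemma ge0_integral_mul_subst (f : R * R -> \bar R) : measurable_fun setT f ->
  (forall y p, (0 < p < y)%R -> (y < 1)%R -> 0 <= f (y, p)) ->
  \int[mu]_(y in `]0%R, 1%R[) \int[mu]_(x in `]0%R, 1%R[) f (y, x * y)%R =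
  \int[mu]_(p in `]0%R, 1%R[) \int[mu]_(y in `]p, 1%R[) ((y^-1)%:E * f (y, p)).
Proof.
move=> mf f0.
transitivity (\int[mu]_(y in `]0%R, 1%R[) \int[mu]_(p in `]0%R, y[) ((y^-1)%:E * f (y, p))).
  apply: eq_integral => y /set_mem /=; rewrite in_itv/= => /andP[y0 y1].
  have f0y p : `]0%R, y[%classic p -> 0 <= f (y, p).
    by rewrite /= in_itv/= => p0y; exact: f0.
  have mfy : measurable_fun `]0%R, y[ (fun p => f (y, p)).
    by apply: measurable_funTS; exact: measurableT_comp.
  rewrite ge0_integralZl ?lee_fin ?invr_ge0 ?ltW//.
  rewrite (ge0_integral_scale y0 _ mfy f0y)// muleA -EFinM mulVf ?gt_eqF// mul1e.
  congr integral; apply/seteqP; split=> x /=.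
    by rewrite !in_itv/= pmulr_lgt0// gtr_pMl.
  by rewrite !in_itv/= pmulr_lgt0// gtr_pMl.
apply: (@tonelli_region _ _ (measurableTypeR R) (measurableTypeR R) R mu mu `]0%R, 1%R[%classic
  (fun y => `]0%R, y[%classic) `]0%R, 1%R[%classic (fun p => `]p, 1%R[%classic)
  (fun z => (z.1^-1)%:E * f z)).
- move=> y p /=; rewrite !in_itv/=; split.
    by move=> [/andP[y0 y1] /andP[p0 py]]; rewrite p0 py y1 (lt_trans py y1).
  by move=> [/andP[p0 p1] /andP[py y1]]; rewrite p0 py y1 (lt_trans p0 py).
- exact: measurable_triangle.
- apply/measurable_funTS/emeasurable_funM => //.
  by apply/measurable_EFinP; solve_measurable.
- move=> y p /=; rewrite !in_itv/= => /andP[/ltW y0 y1] p0y.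
  by rewrite mule_ge0 ?lee_fin ?invr_ge0// f0.
Qed.

Lemma ge0_integral_log_densityS k (h : R -> \bar R) : measurable_fun setT h ->
  (forall x, (0 < x < 1)%R -> 0 <= h x) ->
  \int[mu]_(z in `]0%R, 1%R[) \int[mu]_(x in `]0%R, 1%R[) (h (z * x)%R * (log_density k.+1 x)%:E) =
  \int[mu]_(p in `]0%R, 1%R[) (h p * (log_density k.+2 p)%:E).
Proof.
move=> mh h0; pose f (z : R * R) := h z.2 * (log_density k.+1 z.1)%:E.
have mf : measurable_fun setT f.
  apply: emeasurable_funM; first exact: (measurableT_comp mh).
  by apply/measurable_EFinP/measurable_log_density; exact: measurable_fst.
have f0 x y : (0 < y < x)%R -> (x < 1)%R -> 0 <= f (x, y).
  move=> /andP[y0 yx] x1; rewrite mule_ge0 ?h0 ?y0 ?(lt_trans yx)//.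
  by rewrite lee_fin log_density_ge0// ltW.
transitivity (\int[mu]_(y in `]0%R, 1%R[) \int[mu]_(x in `]0%R, 1%R[) f (y, x * y)%R).
  apply: (@tonelli_region _ _ (measurableTypeR R) (measurableTypeR R) R mu mu `]0%R, 1%R[%classic
    (fun=> `]0%R, 1%R[%classic) `]0%R, 1%R[%classic (fun=> `]0%R, 1%R[%classic)
    (fun z => f (z.2, z.1 * z.2)%R)).
  - by move=> x y; split => -[].
  - exact: measurable_unit_square.
  - apply/measurable_funTS/(measurableT_comp mf)/measurable_fun_pairP; split=> /=; solve_measurable.
  - move=> x y /=; rewrite !in_itv/= => /andP[x0 x1] /andP[y0 y1]; apply: f0 => //.
    by rewrite mulr_gt0//= gtr_pMl.
rewrite (ge0_integral_mul_subst mf f0); apply: eq_integral => p /set_mem/=; rewrite in_itv/= => p01.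
have /andP[p0 _] := p01; rewrite -(integral_log_density_div k p01) -ge0_integralZl ?h0//.
- by apply: eq_integral => y _; rewrite /f/= EFinM muleCA.
- apply/measurable_funTS/measurable_EFinP/measurable_funM; first solve_measurable.
  exact: measurable_log_density.
- move=> y /=; rewrite in_itv/= => /andP[py /ltW y1].
  by rewrite lee_fin mulr_ge0 ?log_density_ge0// invr_ge0 ltW// (lt_trans p0).
Qed.

Lemma integral_log_density k : \int[mu]_(p in `]0%R, 1%R[) (log_density k.+1 p)%:E = 1.
Proof.
have mu01 : \int[mu]_(p in `]0%R, 1%R[) (1%:E : \bar R) = 1.
  by rewrite integral_cst//= mul1e /mu lebesgue_measure_itv/= lte01 oppr0 adde0.
elim: k => [|k ih]; first by under eq_integral do rewrite log_density1.
have := @ge0_integral_log_densityS k (cst 1) (measurable_cst _) (fun _ _ => lee01).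
under [in X in X -> _]eq_integral do under eq_integral do rewrite mul1e.
under [in X in _ = X -> _]eq_integral do rewrite mul1e.
by move=> <-; under eq_integral do rewrite ih.
Qed.

Lemma sum_log_density k x y : (0 < x <= 1)%R -> (0 < y <= 1)%R ->
  (\sum_(1 <= r < k) log_density r x * log_density (k - r) y = log_density k.-1 (x * y))%R.
Proof.
move=> /andP[x0 x1] /andP[y0 y1]; case: k => [|[|m]]; [by rewrite big_geq..|].
rewrite big_add1/= big_mkord [in RHS]/log_density lnM ?posrE// opprD addrC exprDn mulr_suml.
apply: eq_bigr => i _; have im : (i <= m)%N by rewrite -ltnS.
rewrite subSS subSn// /log_density -(bin_fact im) !natrM -mulr_natr.
have fact_neq0 j : (j`!%:R != 0 :> R)%R by rewrite pnatr_eq0 -lt0n fact_gt0.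
have bin_neq0 : ('C(m, i)%:R != 0 :> R)%R by rewrite pnatr_eq0 -lt0n bin_gt0.
by field; rewrite !fact_neq0 bin_neq0.
Qed.

End log_density.

Section unit_cube_integrals.
Local Open Scope ereal_scope.
Context {R : realType}.
Let mu := @lebesgue_measure R.
Notation cube := (unit_cube R).
Notation leb := (lebesgue_tuple R).

Lemma measurable_unit_cube k : measurable (cube k).
Proof.
rewrite (_ : cube k = \bigcap_(i in [set: 'I_k])
    ((fun u : tupleR k R => tnth u i) @^-1` `[0%R, 1%R]%classic)).
  apply: fin_bigcap_measurable => // i _; rewrite -[X in measurable X]setTI.
  by apply: (@measurable_tnth _ (measurableTypeR R) k i) => //; exact: measurable_itv.
by apply/seteqP; split => u h i => [_|]; have := h i; rewrite /= in_itv//=; apply.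
Qed.

Lemma measurable_prod_tnth k (P : pred 'I_k) :
  measurable_fun [set: tupleR k R] (fun u : tupleR k R => \prod_(i < k | P i) (tnth u i : R))%R.
Proof.
rewrite (_ : (fun u => _) = (fun u : tupleR k R =>
    \prod_(i <- enum 'I_k | P i) (tnth u i : R))%R); last first.
  by apply/funext => u; rewrite big_enum_cond.
elim: (enum 'I_k) => [|i s ih].
  by under eq_fun do rewrite big_nil; exact: measurable_cst.
under eq_fun do rewrite big_cons; case: (P i) => //.
by apply: measurable_funM => //; exact: (@measurable_tnth _ (measurableTypeR R) k i).
Qed.

Lemma prod_tnth_unit_itv k (P : pred 'I_k) (u : tupleR k R) : cube k u ->
  (0 <= \prod_(i < k | P i) (tnth u i : R) <= 1)%R.
Proof.
move=> cu; apply: (big_ind (fun x : R => 0 <= x <= 1)%R) => [|x y|i _].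
- by rewrite ler01 lexx.
- by move=> /andP[x0 x1] /andP[y0 y1]; rewrite mulr_ge0//= mulr_ile1.
- exact: cu.
Qed.

Lemma prod_tnth_pair_cons k (x : R) (u : tupleR k R) (P : nat -> bool) :
  (\prod_(i < k.+1 | P i) (tnth (pair_cons (x, u)) i : R) =
   (if P 0%N then x else 1) * \prod_(i < k | P i.+1) (tnth u i : R))%R.
Proof.
rewrite big_mkcond big_ord_recl/= [in RHS]big_mkcond/=; congr (_ * _)%R.
by apply: eq_bigr => i _; rewrite /bump/= add1n; case: ifPn => // _; rewrite tnthS.
Qed.

Lemma pair_cons_unit_cube k (x : R) (u : tupleR k R) :
  cube k.+1 (pair_cons (x, u)) <-> (0 <= x <= 1)%R /\ cube k u.
Proof.
split=> [xu|[x01 u01] i].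
  by split=> [|i]; [have := xu ord0|have := xu (lift ord0 i); rewrite tnthS].
by case: (unliftP ord0 i) => [j ->|->//]; rewrite tnthS; exact: u01.
Qed.

Lemma ge0_integral_unit_cubeS k (g : tupleR k.+1 R -> \bar R) :
  measurable_fun (cube k.+1) g -> (forall u, cube k.+1 u -> 0 <= g u) ->
  \int[leb k.+1]_(u in cube k.+1) g u =
  \int[mu]_(x in `]0%R, 1%R[) \int[leb k]_(u in cube k) g (pair_cons (x, u)).
Proof.
move=> mg g0; have mcons := @measurable_pair_cons R k.
pose C := [set z : measurableTypeR R * tupleR k R |
  `[0%R, 1%R]%classic z.1 /\ (fun=> cube k) z.1 z.2].
have mC : measurable C.
  by apply: (@measurableX _ _ (measurableTypeR R) (tupleR k R) `[0%R, 1%R]%classic) => //;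
    exact: measurable_unit_cube.
have consC : @pair_cons R k @^-1` cube k.+1 = C.
  by apply/seteqP; split=> -[x u]; rewrite /C/= in_itv/= => /pair_cons_unit_cube.
have mgC : measurable_fun C (g \o @pair_cons R k).
  apply: (measurable_comp (@measurable_unit_cube k.+1) _ mg (measurable_funTS mcons)).
  by rewrite -consC => _ [z ? <-].
have g0C x u : `[0%R, 1%R]%classic x -> cube k u -> 0 <= (g \o @pair_cons R k) (x, u).
  by rewrite /= in_itv/= => x01 cu; apply/g0/pair_cons_unit_cube.
transitivity (\int[mu]_(x in `[0%R, 1%R]) \int[leb k]_(u in cube k) g (pair_cons (x, u))).
  rewrite (_ : leb k.+1 = pushforward (mu \x leb k) (@pair_cons R k) :> (set _ -> _))//.
  rewrite (ge0_integral_pushforward mcons)//.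
  - by rewrite consC; exact: (@integral_prod_region _ _ _ _ R mu (leb k) `[0%R, 1%R]%classic
      (fun=> cube k) (g \o @pair_cons R k) mC mgC g0C).
  - exact: measurable_unit_cube.
  - by move=> u /set_mem; exact: g0.
rewrite integral_itv_bndoo//.
have := @measurable_integral_region _ _ (measurableTypeR R) _ R (leb k) `[0%R, 1%R]%classic
  (fun=> cube k) (g \o @pair_cons R k) mC mgC g0C (measurable_itv _).
by apply: measurable_funS => //; exact: subset_itv_oo_cc.
Qed.

Lemma integral_unit_cube0 (g : tupleR 0 R -> \bar R) :
  \int[leb 0]_(u in cube 0) g u = g [tuple].
Proof.
rewrite (eq_integral (cst (g [tuple]))) => [|u _]; last by rewrite (tuple0 u).
rewrite integral_cst//=; last exact: measurable_unit_cube.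
by rewrite diracE mem_set ?mule1// => -[].
Qed.

Lemma ge0_integral_unit_cube_prod k (h : R -> \bar R) : measurable_fun setT h ->
  (forall x, (0 <= x <= 1)%R -> 0 <= h x) ->
  \int[leb k.+1]_(u in cube k.+1) h (\prod_(i < k.+1) (tnth u i : R))%R =
  \int[mu]_(x in `]0%R, 1%R[) (h x * (log_density k.+1 x)%:E).
Proof.
move=> mh h0; elim: k h mh h0 => [|k ih] h mh h0; rewrite ge0_integral_unit_cubeS.
- apply: eq_integral => x _; rewrite integral_unit_cube0 (prod_tnth_pair_cons _ _ xpredT).
  by rewrite big_ord0 mulr1 log_density1 mule1.
- by apply: measurable_funTS; exact: measurableT_comp mh (measurable_prod_tnth _).
- by move=> u cu; exact/h0/prod_tnth_unit_itv.
- rewrite -ge0_integral_log_densityS//; last by move=> x /andP[/ltW x0 /ltW x1]; rewrite h0 ?x0.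
  apply: eq_integral => x /set_mem/=; rewrite in_itv/= => /andP[/ltW x0 /ltW x1].
  under eq_integral do rewrite (prod_tnth_pair_cons _ _ xpredT).
  apply: (ih (fun y => h (x * y)%R)) => [|y /andP[y0 y1]].
    by apply: (measurableT_comp mh); exact: mulrl_measurable.
  by apply: h0; rewrite mulr_ge0// mulr_ile1.
- by apply: measurable_funTS; exact: measurableT_comp mh (measurable_prod_tnth _).
- by move=> u cu; exact/h0/prod_tnth_unit_itv.
Qed.

Lemma ge0_integral_unit_cube_split r s (f : R * R -> \bar R) : measurable_fun setT f ->
  (forall x y, (0 <= x <= 1)%R -> (0 <= y <= 1)%R -> 0 <= f (x, y)) ->
  \int[leb (r + s)]_(u in cube (r + s))
    f ((\prod_(i < r + s | (i < r)%N) (tnth u i : R))%R,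
       (\prod_(i < r + s | (r <= i)%N) (tnth u i : R))%R) =
  \int[leb r]_(v in cube r) \int[leb s]_(u in cube s)
    f ((\prod_(i < r) (tnth v i : R))%R, (\prod_(i < s) (tnth u i : R))%R).
Proof.
elim: r f => [|r ih] f mf f0.
  rewrite integral_unit_cube0 big_ord0; apply: eq_integral => u _.
  by rewrite big_pred0.
have m_products : measurable_fun setT (fun u : tupleR (r + s).+1 R =>
    f ((\prod_(i < (r + s).+1 | (i < r.+1)%N) (tnth u i : R))%R,
       (\prod_(i < (r + s).+1 | (r.+1 <= i)%N) (tnth u i : R))%R)).
  by apply/(measurableT_comp mf)/measurable_fun_pairP; split; exact: measurable_prod_tnth.
have m_inner : measurable_fun (cube r.+1) (fun v => \int[leb s]_(u in cube s)
    f ((\prod_(i < r.+1) (tnth v i : R))%R, (\prod_(i < s) (tnth u i : R))%R)).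
  apply: (@measurable_integral_region _ _ (tupleR r.+1 R) (tupleR s R) R (leb s) (cube r.+1)
    (fun=> cube s) (fun z => f ((\prod_(i < r.+1) (tnth z.1 i : R))%R,
      (\prod_(i < s) (tnth z.2 i : R))%R))).
  - by apply: measurableX; exact: measurable_unit_cube.
  - apply/measurable_funTS/(measurableT_comp mf)/measurable_fun_pairP; split.
      exact: measurableT_comp (measurable_prod_tnth _) measurable_fst.
    exact: measurableT_comp (measurable_prod_tnth _) measurable_snd.
  - by move=> v u cv cu; apply: f0; exact: prod_tnth_unit_itv.
  - exact: measurable_unit_cube.
rewrite [LHS](@ge0_integral_unit_cubeS (r + s)) => [||u cu]; last 2 first.
- exact: measurable_funTS.
- by apply: f0; exact: prod_tnth_unit_itv.
rewrite [RHS]ge0_integral_unit_cubeS// => [|v cv]; last first.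
  by apply: integral_ge0 => u cu; apply: f0; exact: prod_tnth_unit_itv.
apply: eq_integral => x /set_mem/=; rewrite in_itv/= => /andP[/ltW x0 /ltW x1].
under [RHS]eq_integral do under eq_integral do rewrite (prod_tnth_pair_cons _ _ xpredT).
rewrite -(ih (fun z => f (x * z.1, z.2)%R)).
- apply: eq_integral => u _.
  by rewrite (prod_tnth_pair_cons x u (fun i => i < r.+1)%N)
     (prod_tnth_pair_cons x u (fun i => r.+1 <= i)%N) /= mul1r.
- apply/(measurableT_comp mf)/measurable_fun_pairP; split=> /=; solve_measurable.
- by move=> y z /andP[y0 y1] z01; apply: f0; rewrite // mulr_ge0//= mulr_ile1.
Qed.

Lemma ge0_integral_unit_cube_prod2 r s (f : R * R -> \bar R) : measurable_fun setT f ->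
  (forall x y, (0 <= x <= 1)%R -> (0 <= y <= 1)%R -> 0 <= f (x, y)) ->
  \int[leb (r.+1 + s.+1)]_(u in cube (r.+1 + s.+1))
    f ((\prod_(i < r.+1 + s.+1 | (i < r.+1)%N) (tnth u i : R))%R,
       (\prod_(i < r.+1 + s.+1 | (r.+1 <= i)%N) (tnth u i : R))%R) =
  \int[mu]_(x in `]0%R, 1%R[) \int[mu]_(y in `]0%R, 1%R[)
    (f (x, y) * (log_density r.+1 x * log_density s.+1 y)%:E).
Proof.
move=> mf f0; rewrite ge0_integral_unit_cube_split//.
pose I := `[0%R, 1%R]%classic : set R; pose J := `]0%R, 1%R[%classic : set R.
pose g x := \int[mu]_(y in J) (f (x, y) * (log_density s.+1 y)%:E).
have fld0 x y : I x -> J y -> 0 <= f (x, y) * (log_density s.+1 y)%:E.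
  rewrite /I /J/= !in_itv/= => x01 /andP[/ltW y0 /ltW y1].
  by rewrite mule_ge0 ?f0 ?y0// lee_fin log_density_ge0.
have mg : measurable_fun I g.
  apply: (@measurable_integral_region _ _ (measurableTypeR R) (measurableTypeR R) R mu
    I (fun=> J) (fun z => f z * (log_density s.+1 z.2)%:E)) => //.
  - by apply: (@measurableX _ _ (measurableTypeR R) (measurableTypeR R) I J);
      exact: measurable_itv.
  - apply/measurable_funTS/emeasurable_funM => //.
    by apply/measurable_EFinP/measurable_log_density; exact: measurable_snd.
  - exact: measurable_itv.
transitivity (\int[leb r.+1]_(v in cube r.+1) (g \_ I) (\prod_(i < r.+1) (tnth v i : R))%R).
  apply: eq_integral => v /set_mem cv; have v01 := prod_tnth_unit_itv xpredT cv.
  rewrite patchE mem_set/= ?/I/= ?in_itv//.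
  apply: (@ge0_integral_unit_cube_prod s (fun y => f (_, y))) => [|y]; last exact: f0.
  by apply: (measurableT_comp mf); exact: measurable_pair1.
rewrite ge0_integral_unit_cube_prod; last 2 first.
- exact/(measurable_restrictT _ (measurable_itv _)).
- by move=> x _; apply: erestrict_ge0 => y Iy; apply: integral_ge0 => z; exact: fld0.
apply: eq_integral => x /set_mem/=; rewrite in_itv/= => /andP[/ltW x0 /ltW x1].
have Ix : I x by rewrite /I/= in_itv/= x0.
rewrite patchE mem_set// -ge0_integralZr ?lee_fin ?log_density_ge0//.
- by apply: eq_integral => y _; rewrite -muleA -EFinM mulrC.
- exact: measurable_itv.
- apply/measurable_funTS/emeasurable_funM; first exact: measurableT_comp.
  by apply/measurable_EFinP/measurable_log_density; exact: measurable_id.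
- by move=> y; exact: fld0.
Qed.

End unit_cube_integrals.

(** * Reduction to moments of fiber integrals *)

Section fiber_kernel.
Context {R : realType}.
Implicit Types (p y : R) (n : nat).

Definition radicand p y : R := 4 * p ^+ 2 + (1 - p ^+ 2) ^+ 2 * y ^+ 2.

Definition root_kernel p y : R := (Num.sqrt (radicand p y))^-1.

Definition beta_weight n y : R := (1 - y ^+ 2) ^+ n.

Lemma onem_sqr_gt0 p : 0 < p < 1 -> 0 < 1 - p ^+ 2.
Proof. by move=> /andP[p0 p1]; rewrite subr_gt0 expr_lt1// ltW. Qed.

Lemma radicand_gt0 p y : 0 < p -> 0 < radicand p y.
Proof.
move=> p0; rewrite /radicand ltr_pwDl ?mulr_gt0 ?exprn_gt0//.
by rewrite mulr_ge0 ?sqr_ge0.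
Qed.

Lemma root_kernel_gt0 p y : 0 < p -> 0 < root_kernel p y.
Proof. by move=> p0; rewrite invr_gt0 sqrtr_gt0 radicand_gt0. Qed.

Lemma root_kernelX2_radicand p y : 0 < p -> root_kernel p y ^+ 2 * radicand p y = 1.
Proof.
move=> p0; rewrite /root_kernel exprVn sqr_sqrtr; last exact/ltW/radicand_gt0.
by rewrite mulVf// gt_eqF// radicand_gt0.
Qed.

Lemma derives_root_kernel_y p y : 0 < p ->
  derives (root_kernel p) y (- ((1 - p ^+ 2) ^+ 2 * y) * root_kernel p y ^+ 3).
Proof.
move=> p0; have drad : derives (radicand p) y (2 * (1 - p ^+ 2) ^+ 2 * y).
  by apply: derives_eq => /=; ring.
apply: derives_eq (derives_invsqrt (radicand_gt0 y p0) drad) _.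
by rewrite -/(root_kernel p y); field.
Qed.

Lemma derives_root_kernel_p p y : 0 < p ->
  derives (root_kernel ^~ y) p
    (- (4 * p - 2 * p * (1 - p ^+ 2) * y ^+ 2) * root_kernel p y ^+ 3).
Proof.
move=> p0.
have drad : derives (radicand ^~ y) p (8 * p - 4 * p * (1 - p ^+ 2) * y ^+ 2).
  by apply: derives_eq => /=; ring.
apply: derives_eq (@derives_invsqrt _ (radicand ^~ y) _ _ (radicand_gt0 y p0) drad) _.
by rewrite -/(root_kernel p y); field.
Qed.

Lemma derives_beta_weight n y :
  derives (beta_weight n) y (- (2 * n%:R * y * beta_weight n.-1 y)).
Proof. by apply: derives_eq; rewrite /beta_weight/=; ring. Qed.

Lemma measurable_root_kernel d (T : measurableType d) (f g : T -> R) :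
  measurable_fun setT f -> measurable_fun setT g ->
  measurable_fun setT (fun z => root_kernel (f z) (g z)).
Proof.
move=> mf mg; apply: measurable_funV; apply: measurableT_comp.
  by apply: continuous_measurable_fun; exact: sqrt_continuous.
by solve_measurable.
Qed.

Lemma measurable_beta_weight d (T : measurableType d) (f : T -> R) n :
  measurable_fun setT f -> measurable_fun setT (fun z => beta_weight n (f z)).
Proof. by move=> mf; solve_measurable. Qed.

End fiber_kernel.

Section J_kernel.
Context {R : realType}.
Implicit Types (p x y : R) (n : nat).
Let mu := @lebesgue_measure R.

Definition J_kernel n x y : R :=
  (1 - x ^+ 4) ^+ n * (1 - y ^+ 4) ^+ n / (1 - (x * y) ^+ 2) ^+ (2 * n + 1).

Lemma J_kernel_ge0 n x y : 0 <= x <= 1 -> 0 <= y <= 1 -> 0 <= J_kernel n x y.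
Proof.
move=> /andP[x0 x1] /andP[y0 y1]; rewrite divr_ge0 ?mulr_ge0// exprn_ge0// subr_ge0.
- by rewrite exprn_ile1.
- by rewrite exprn_ile1.
- by rewrite exprn_ile1 ?mulr_ge0 ?mulr_ile1.
Qed.

Lemma measurable_J_kernel d (T : measurableType d) (f g : T -> R) n :
  measurable_fun setT f -> measurable_fun setT g ->
  measurable_fun setT (fun z => J_kernel n (f z) (g z)).
Proof. by move=> mf mg; solve_measurable. Qed.

(* With [x ^+ 2 = exp (- a)] and [p = exp (- t / 2)] this is
   [sinh (a - t / 2) / sinh (t / 2)]. *)
Definition fiber_chart p x : R := (p ^+ 2 / x ^+ 2 - x ^+ 2) / (1 - p ^+ 2).

Lemma derives_fiber_chart p x : 0 < x ->
  derives (fiber_chart p) x (- (2 / x * (p ^+ 2 / x ^+ 2 + x ^+ 2) / (1 - p ^+ 2))).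
Proof.
move=> x0; have x20 : x ^+ 2 != 0 by rewrite expf_eq0/= gt_eqF.
have dV := @derivesV _ (fun y => y ^+ 2) x _ x20 _.
apply: derives_eq; rewrite /= expr1.
by move: (1 - p ^+ 2)^-1 => c; field; rewrite gt_eqF.
Qed.

Lemma fiber_chart_decreasing p x y : 0 < p < 1 -> 0 < x -> x < y ->
  fiber_chart p y < fiber_chart p x.
Proof.
move=> /andP[p0 p1] x0 xy; have y0 := lt_trans x0 xy.
have x2y2 : x ^+ 2 < y ^+ 2 by rewrite ltrXn2r// ?nnegrE ltW.
rewrite ltr_pM2r ?invr_gt0 ?subr_gt0 ?expr_lt1 ?(ltW p0)// ltrD ?ltrN2//.
by rewrite ltr_pM2l ?exprn_gt0// ltf_pV2// ?posrE exprn_gt0.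
Qed.

Lemma root_kernel_fiber_chart p x : 0 < p < 1 -> 0 < x ->
  root_kernel p (fiber_chart p x) = (p ^+ 2 / x ^+ 2 + x ^+ 2)^-1.
Proof.
move=> p01 x0; have /andP[p0 _] := p01; have q0 := onem_sqr_gt0 p01.
rewrite /root_kernel (_ : radicand _ _ = (p ^+ 2 / x ^+ 2 + x ^+ 2) ^+ 2).
  by rewrite sqrtr_sqr ger0_norm// addr_ge0 ?divr_ge0 ?sqr_ge0.
by rewrite /radicand /fiber_chart; field; rewrite !gt_eqF.
Qed.

Lemma beta_weight_fiber_chart n p x : 0 < p < 1 -> 0 < x ->
  beta_weight n (fiber_chart p x) =
  (1 - x ^+ 4) ^+ n * (1 - (p / x) ^+ 4) ^+ n / (1 - p ^+ 2) ^+ (2 * n).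
Proof.
move=> p01 x0; have /andP[p0 _] := p01; have q0 := onem_sqr_gt0 p01.
rewrite exprM -!exprMn -exprVn -exprMn /beta_weight; congr (_ ^+ n).
by rewrite /fiber_chart; field; rewrite !gt_eqF.
Qed.

Lemma J_kernel_fiber_chart n p x : 0 < p < 1 -> 0 < x ->
  x^-1 * J_kernel n x (p / x) = 2^-1 *
    (beta_weight n (fiber_chart p x) * root_kernel p (fiber_chart p x)
     * (2 / x * (p ^+ 2 / x ^+ 2 + x ^+ 2) / (1 - p ^+ 2))).
Proof.
move=> p01 x0; rewrite beta_weight_fiber_chart// root_kernel_fiber_chart//.
have /andP[p0 p1] := p01; have q0 := onem_sqr_gt0 p01.
have s0 : 0 < p ^+ 2 / x ^+ 2 + x ^+ 2 by rewrite addr_gt0 ?divr_gt0 ?exprn_gt0.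
rewrite /J_kernel [x * (p / x)]mulrCA mulfV ?gt_eqF// mulr1 exprD expr1.
have qn0 : (1 - p ^+ 2) ^+ (2 * n) != 0 by rewrite expf_eq0 gt_eqF// andbF.
move: (_ ^+ (2 * n)) (p ^+ 2 / x ^+ 2 + x ^+ 2) qn0 s0 => qn s qn0 s0.
by field; rewrite qn0 !gt_eqF.
Qed.

Lemma integral_J_kernel n p : 0 < p < 1 ->
  (\int[mu]_(x in `]p, 1%R[) (x^-1 * J_kernel n x (p / x))%:E =
   (2^-1)%:E * \int[mu]_(y in `[(-1)%R, 1%R]) (beta_weight n y * root_kernel p y)%:E)%E.
Proof.
move=> p01; have /andP[p0 p1] := p01; have q0 := onem_sqr_gt0 p01.
have pos x : p <= x <= 1 -> 0 < x by move=> /andP[px _]; exact: lt_le_trans px.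
have chart_p : fiber_chart p p = 1 by rewrite /fiber_chart; field; rewrite !gt_eqF.
have chart_1 : fiber_chart p 1 = -1 by rewrite /fiber_chart; field; rewrite !gt_eqF.
pose f x := 2 / x * (p ^+ 2 / x ^+ 2 + x ^+ 2) / (1 - p ^+ 2).
have cont_f : {in `[p, 1], continuous (fun x => - f x)}.
  move=> x; rewrite in_itv/= => /pos x0; have x20 : x ^+ 2 != 0 by rewrite expf_eq0/= gt_eqF.
  have dV1 := @derivesV _ (fun y => y) x _ (lt0r_neq0 x0) _.
  have dV2 := @derivesV _ (fun y => y ^+ 2) x _ x20 _.
  exact: derives_continuous.
have cont_G : {within `[fiber_chart p 1, fiber_chart p p],
    continuous (fun y => beta_weight n y * root_kernel p y)}.
  apply: continuous_subspaceT => y.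
  have dbeta := derives_beta_weight n y; have droot := derives_root_kernel_y y p0.
  exact: derives_continuous.
have := derives_substitution_decreasing p1 (fun x xp1 => derives_fiber_chart p (pos x xp1))
  cont_f _ cont_G.
rewrite chart_p chart_1 => -> => [|x y]; last first.
  by rewrite !in_itv/= => _ /pos; exact: fiber_chart_decreasing.
have mJ : measurable_fun setT (fun x => (x^-1 * J_kernel n x (p / x))%:E).
  apply/measurable_EFinP/measurable_funM; first solve_measurable.
  by apply: measurable_J_kernel; solve_measurable.
rewrite -(@integral_itv_bndoo _ p 1 _ true false); last exact: measurable_funTS.
rewrite [X in (_ * X)%E](_ : _ =
    \int[mu]_(x in `[p, 1%R]) (2%:E * (x^-1 * J_kernel n x (p / x))%:E))%E; last first.
  apply: eq_integral => x /set_mem/=; rewrite in_itv/= => /pos x0.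
  by rewrite J_kernel_fiber_chart// opprK -EFinM [in RHS]mulrA mulfV// mul1r.
rewrite ge0_integralZl ?muleA -?EFinM ?mulVf ?mul1e//; first exact: measurable_funTS.
move=> x; rewrite /= in_itv/= => /[dup] /pos x0 /andP[px x1].
rewrite lee_fin mulr_ge0 ?invr_ge0 ?J_kernel_ge0 ?(ltW x0)//.
by rewrite divr_ge0 ?(ltW p0) ?(ltW x0)//= ler_pdivrMr// mul1r.
Qed.

End J_kernel.

Section J_reduction.
Context {R : realType}.
Local Open Scope ereal_scope.
Implicit Types (p x y : R) (n r k : nat).
Let mu := @lebesgue_measure R.

Lemma J_integrandE n r k (u : tupleR k R) : J_integrand n r u =
  J_kernel n (\prod_(i < k | (i < r)%N) (tnth u i : R)) (\prod_(i < k | (r <= i)%N) (tnth u i : R)).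
Proof.
rewrite /J_integrand /J_kernel !prodrXl; congr (_ / (1 - _ ^+ 2) ^+ _)%R.
rewrite (bigID (fun i : 'I_k => (i < r)%N))/=; congr (_ * _)%R.
by apply: eq_bigl => i; rewrite -leqNgt.
Qed.

Lemma measurable_J_integrand n r k : measurable_fun setT (@J_integrand R k n r).
Proof.
rewrite (funext (@J_integrandE n r k)).
by apply: measurable_J_kernel; exact: measurable_prod_tnth.
Qed.

Lemma J_integrand_ge0 n r k (u : tupleR k R) : unit_cube R k u -> (0 <= J_integrand n r u)%R.
Proof. by move=> cu; rewrite J_integrandE J_kernel_ge0// prod_tnth_unit_itv. Qed.

Lemma integral_J_integrand n r k : (0 < r < k)%N ->
  \int[lebesgue_tuple R k]_(u in unit_cube R k) (J_integrand n r u)%:E =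
  \int[mu]_(x in `]0%R, 1%R[) \int[mu]_(y in `]0%R, 1%R[)
    (J_kernel n x y * (log_density r x * log_density (k - r) y))%:E.
Proof.
case: r => // r /= /subnKC; move: (k - r.+2)%N => s; rewrite addSnnS => <-; rewrite addKn.
under eq_integral do rewrite J_integrandE.
rewrite (@ge0_integral_unit_cube_prod2 R r s (fun z => (J_kernel n z.1 z.2)%:E)) => [||x y x01 y01].
- by [].
- by apply/measurable_EFinP/measurable_J_kernel; solve_measurable.
- by rewrite lee_fin J_kernel_ge0.
Qed.

Let weighted_ge0 n r s x y : `]0%R, 1%R[%classic x -> `]0%R, 1%R[%classic y ->
  0 <= (J_kernel n x y * (log_density r x * log_density s y))%:E.
Proof.
rewrite /= !in_itv/= => /andP[/ltW x0 /ltW x1] /andP[/ltW y0 /ltW y1].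
by rewrite lee_fin mulr_ge0 ?J_kernel_ge0 ?x0 ?y0// mulr_ge0 ?log_density_ge0.
Qed.

Let measurable_weighted n r s d (T : measurableType d) (f g : T -> R) :
  measurable_fun setT f -> measurable_fun setT g -> measurable_fun setT (fun z =>
    (J_kernel n (f z) (g z) * (log_density r (f z) * log_density s (g z)))%:E).
Proof.
move=> mf mg; apply/measurable_EFinP/measurable_funM; first exact: measurable_J_kernel.
by apply: measurable_funM; exact: measurable_log_density.
Qed.

Lemma sum_integral_J_integrand n k :
  \sum_(1 <= r < k) \int[lebesgue_tuple R k]_(u in unit_cube R k) (J_integrand n r u)%:E =
  \int[mu]_(x in `]0%R, 1%R[) \int[mu]_(y in `]0%R, 1%R[)
    (J_kernel n x y * log_density k.-1 (x * y)%R)%:E.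
Proof.
rewrite (eq_big_nat _ _ (fun r => @integral_J_integrand n r k)).
rewrite -ge0_integral_sum//; last 2 first.
- move=> r; apply (@measurable_integral_region _ _ (measurableTypeR R) (measurableTypeR R) R mu
    `]0%R, 1%R[%classic (fun=> `]0%R, 1%R[%classic) (fun z =>
    (J_kernel n z.1 z.2 * (log_density r z.1 * log_density (k - r) z.2))%:E)) => //.
  + exact: measurable_unit_square.
  + by apply: measurable_funTS; exact: measurable_weighted measurable_fst measurable_snd.
  + exact: weighted_ge0.
- by move=> r x x01; apply: integral_ge0 => y y01; exact: weighted_ge0.
apply: eq_integral => x /set_mem x01; rewrite -ge0_integral_sum//; last 2 first.
- move=> r; apply: measurable_funTS.
  exact: (@measurable_weighted n r (k - r) _ _ (cst x) id).
- by move=> r y y01; exact: weighted_ge0.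
apply: eq_integral => y /set_mem/=; move: x01; rewrite /= !in_itv/=.
move=> /andP[x0 /ltW x1] /andP[y0 /ltW y1]; rewrite sumEFin -big_distrr/= sum_log_density ?x0//.
by rewrite y0.
Qed.

Lemma sum_integral_J_integrand_fiber n k :
  \sum_(1 <= r < k) \int[lebesgue_tuple R k]_(u in unit_cube R k) (J_integrand n r u)%:E =
  \int[mu]_(p in `]0%R, 1%R[) ((log_density k.-1 p)%:E *
    \int[mu]_(x in `]p, 1%R[) (x^-1 * J_kernel n x (p / x))%:E).
Proof.
rewrite sum_integral_J_integrand.
pose f (z : R * R) := (J_kernel n z.1 (z.2 / z.1) * log_density k.-1 z.2)%:E.
have J_ge0 x p : (0 < p < x)%R -> (x < 1)%R -> (0 <= J_kernel n x (p / x))%R.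
  move=> /andP[p0 px] x1; have x0 := lt_trans p0 px.
  rewrite J_kernel_ge0 ?(ltW x0) ?(ltW x1)// divr_ge0 ?(ltW p0) ?(ltW x0)//=.
  by rewrite ler_pdivrMr// mul1r ltW.
transitivity (\int[mu]_(x in `]0%R, 1%R[) \int[mu]_(y in `]0%R, 1%R[) f (x, y * x)%R).
  apply: eq_integral => x /set_mem/=; rewrite in_itv/= => /andP[x0 _].
  by apply: eq_integral => y _; rewrite /f/= mulfK ?gt_eqF// (mulrC y).
rewrite ge0_integral_mul_subst => [||x p pltx x1]; last 2 first.
- apply/measurable_EFinP/measurable_funM; first by apply: measurable_J_kernel; solve_measurable.
  by apply: measurable_log_density; solve_measurable.
- rewrite lee_fin mulr_ge0 ?J_ge0// log_density_ge0//.
  by have /andP[_ /ltW px] := pltx; exact: le_trans px (ltW x1).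
apply: eq_integral => p /set_mem/=; rewrite in_itv/= => /andP[p0 /ltW p1].
rewrite -ge0_integralZl ?lee_fin ?log_density_ge0//.
- by apply: eq_integral => x _; rewrite /f/= -!EFinM mulrA mulrC.
- apply/measurable_funTS/measurable_EFinP/measurable_funM; first solve_measurable.
  by apply: measurable_J_kernel; solve_measurable.
- move=> x; rewrite /= in_itv/= => /andP[px x1]; have x0 := lt_trans p0 px.
  by rewrite lee_fin mulr_ge0 ?invr_ge0 ?(ltW x0)// J_ge0 ?p0.
Qed.

End J_reduction.

Section J_log_moment.
Context {R : realType}.
Implicit Types (p x y : R) (n r k : nat).
Let mu := @lebesgue_measure R.

Lemma beta_weight_ge0 n y : `[(-1)%R, 1%R]%classic y -> 0 <= beta_weight n y.
Proof.
rewrite /= in_itv/= => /andP[y1 y2]; apply: exprn_ge0.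
by rewrite (_ : 1 - y ^+ 2 = (1 - y) * (1 + y)); [rewrite mulr_ge0//; lra|ring].
Qed.

Lemma beta_weight_le1 n y : `[(-1)%R, 1%R]%classic y -> beta_weight n y <= 1.
Proof.
move=> /(beta_weight_ge0 1); rewrite /beta_weight expr1 => y0.
by rewrite exprn_ile1// gerBl sqr_ge0.
Qed.

Definition fiber_int n p : R := \int[mu]_(y in `[(-1), 1]) (beta_weight n y * root_kernel p y).

Lemma integrable_segment (f : R -> R) (a b : R) :
  continuous f -> mu.-integrable `[a, b] (EFin \o f).
Proof.
move=> cf; apply: continuous_compact_integrable; first exact: segment_compact.
exact: continuous_subspaceT.
Qed.

Lemma continuous_fiber_integrand n p : 0 < p ->
  continuous (fun y => beta_weight n y * root_kernel p y).
Proof.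
move=> p0 y; have db := derives_beta_weight n y; have dr := derives_root_kernel_y y p0.
exact: derives_continuous.
Qed.

Lemma integrable_fiber_integrand n p : 0 < p ->
  mu.-integrable `[(-1), 1] (EFin \o (fun y => beta_weight n y * root_kernel p y)).
Proof. by move=> p0; exact/integrable_segment/continuous_fiber_integrand. Qed.

Lemma EFin_fiber_int n p : 0 < p -> (fiber_int n p)%:E =
  (\int[mu]_(y in `[(-1)%R, 1%R]) (beta_weight n y * root_kernel p y)%:E)%E.
Proof.
by move=> p0; rewrite fineK//; exact: integrable_fin_num (integrable_fiber_integrand n p0).
Qed.

Lemma fiber_int_ge0 n p : 0 < p -> 0 <= fiber_int n p.
Proof.
move=> p0; apply: Rintegral_ge0 => y Iy.
by rewrite mulr_ge0 ?beta_weight_ge0// ltW// root_kernel_gt0.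
Qed.

Lemma fiber_int_le n p : 0 < p -> fiber_int n p <= fiber_int 0 p.
Proof.
move=> p0; apply: le_Rintegral => [//|||y Iy]; try exact: integrable_fiber_integrand.
rewrite ler_wpM2r ?(ltW (root_kernel_gt0 _ p0))//.
by rewrite {2}/beta_weight expr0 beta_weight_le1.
Qed.

Lemma fiber_int0E p : 0 < p < 1 -> fiber_int 0 p = 2 * (log_density 2 p / (1 - p ^+ 2)).
Proof.
move=> p01; have /andP[p0 p1] := p01.
have := integral_J_kernel 0 p01; rewrite -EFin_fiber_int//.
rewrite (@eq_integral _ _ _ mu _ (fun x => ((1 - p ^+ 2)^-1)%:E *
    (x^-1 * log_density 1 x)%:E)%E) => [|x /set_mem/=]; last first.
  rewrite in_itv/= => /andP[px _]; rewrite log_density1 -EFinM /J_kernel !expr0 !mul1r.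
  rewrite (_ : x * (p / x) = p); last by field; rewrite gt_eqF// (lt_trans p0).
  by rewrite muln0 expr1 mulr1 mulrC.
have m_div : measurable_fun setT (fun x : R => (x^-1 * log_density 1 x)%:E).
  apply/measurable_EFinP/measurable_funM; first solve_measurable.
  exact: measurable_log_density.
rewrite ge0_integralZl//.
- rewrite integral_log_density_div// -!EFinM => -[fiberE].
  by rewrite [log_density 2 p / _]mulrC fiberE mulrA mulfV// mul1r.
- exact: measurable_funTS.
- move=> x; rewrite /= in_itv/= => /andP[px _]; rewrite log_density1 mulr1 lee_fin invr_ge0.
  exact/ltW/(lt_trans p0).
- by rewrite lee_fin invr_ge0 subr_ge0 exprn_ile1// ltW.
Qed.

Lemma log_density2 p : log_density 2 p = - ln p.
Proof. by rewrite /log_density expr1 factS fact0 muln1 divr1. Qed.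

Lemma log_density_mul2 k p : log_density k p * log_density 2 p = k%:R * log_density k.+1 p.
Proof.
rewrite log_density2; case: k => [|k]; first by rewrite !mul0r.
have fact_neq0 : k`!%:R != 0 :> R by rewrite pnatr_eq0 -lt0n fact_gt0.
rewrite /log_density factS natrM [_ ^+ k.+1]exprS.
by field; rewrite fact_neq0/= addrC natr1 pnatr_eq0.
Qed.

(* From [- ln p <= p^-1 - 1]. *)
Lemma fiber_int_le_log n p : 0 < p < 1 -> fiber_int n p <= 2 * (1 + log_density 2 p).
Proof.
move=> p01; have /andP[p0 p1] := p01; have q0 := onem_sqr_gt0 p01.
apply: (le_trans (fiber_int_le n p0)); rewrite fiber_int0E// ler_pM2l// ler_pdivrMr//.
have ln_le : - ln p <= p^-1 - 1.
  have := @le_ln1Dx _ (p^-1 - 1); rewrite [1 + _]addrC subrK lnV ?posrE//; apply.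
  by rewrite ltrBrDr addNr invr_gt0.
have : - ln p * p ^+ 2 <= (p^-1 - 1) * p ^+ 2 by rewrite ler_wpM2r// sqr_ge0.
have -> : (p^-1 - 1) * p ^+ 2 = p - p ^+ 2 by field; rewrite gt_eqF.
by rewrite log_density2; nra.
Qed.

Lemma measurable_fiber_int n : measurable_fun (`]0, 1[%classic : set R) (fiber_int n).
Proof.
apply/measurable_EFinP.
apply: (@eq_measurable_fun _ _ (measurableTypeR R) _ _ (fun p =>
    \int[mu]_(y in `[(-1)%R, 1%R]) (beta_weight n y * root_kernel p y)%:E)%E).
  by move=> p /set_mem/=; rewrite in_itv/= => /andP[p0 _]; rewrite EFin_fiber_int.
apply: (@measurable_integral_region _ _ (measurableTypeR R) (measurableTypeR R) R mu
  `]0, 1[%classic (fun=> `[(-1), 1]%classic)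
  (fun z => (beta_weight n z.2 * root_kernel z.1 z.2)%:E)) => //.
- exact: (@measurableX _ _ (measurableTypeR R) (measurableTypeR R) `]0, 1[ `[(-1), 1]).
- apply/measurable_funTS/measurable_EFinP/measurable_funM.
    by apply: measurable_beta_weight; exact: measurable_snd.
  by apply: measurable_root_kernel; solve_measurable.
- move=> p y; rewrite /= in_itv/= => /andP[p0 _] Iy; rewrite lee_fin.
  by rewrite mulr_ge0 ?beta_weight_ge0// ltW// root_kernel_gt0.
Qed.

Lemma integrable_log_density k : mu.-integrable `]0, 1[ (EFin \o log_density k).
Proof.
have mld : measurable_fun setT (@log_density R k) by exact: measurable_log_density.
apply/integrableP; split; first by apply/measurable_funTS/measurable_EFinP.
rewrite (@eq_integral _ _ _ mu _ (fun p => (log_density k p)%:E)) => [|p /set_mem/=]; last first.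
  by rewrite in_itv/= => /andP[_ /ltW p1]; rewrite ger0_norm// log_density_ge0.
case: k {mld} => [|k]; last by rewrite integral_log_density ltry.
by rewrite integral0_eq.
Qed.

Lemma log_density_fiber_int_ge0 k n p : `]0, 1[%classic p -> 0 <= log_density k p * fiber_int n p.
Proof.
by rewrite /= in_itv/= => /andP[p0 /ltW p1]; rewrite mulr_ge0 ?log_density_ge0 ?fiber_int_ge0.
Qed.

Lemma integrable_log_density_fiber_int k n :
  mu.-integrable `]0, 1[ (EFin \o (fun p => log_density k p * fiber_int n p)).
Proof.
have mI : measurable (`]0, 1[%classic : set (measurableTypeR R)) by exact: measurable_itv.
have ibound : mu.-integrable `]0, 1[
    (EFin \o (fun p => 2 * log_density k p + 2 * k%:R * log_density k.+1 p)).
  by have := integrableD mI (integrableZl mI 2 (integrable_log_density k))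
    (integrableZl mI (2 * k%:R) (integrable_log_density k.+1)); apply: eq_integrable.
apply: le_integrable ibound => //.
  apply/measurable_EFinP; apply: measurable_funM; last exact: measurable_fiber_int.
  by apply: measurable_funTS; exact: measurable_log_density.
move=> p Ip; rewrite lee_fin ger0_norm ?log_density_fiber_int_ge0//.
move: Ip; rewrite /= in_itv/= => /[dup] p01 /andP[p0 /ltW p1].
have ld0 j : 0 <= log_density j p by exact: log_density_ge0.
apply: le_trans (ler_norm _).
apply: le_trans (ler_wpM2l (ld0 k) (fiber_int_le_log n p01)) _.
by have := log_density_mul2 k p; lra.
Qed.

Definition log_moment k n : R := \int[mu]_(p in `]0, 1[) (log_density k p * fiber_int n p).

Lemma log_moment0 n : log_moment 0 n = 0.
Proof.
rewrite /log_moment; under eq_Rintegral do rewrite mul0r.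
by rewrite Rintegral_cst ?mul0r.
Qed.

Lemma log_moment_ge0 k n : 0 <= log_moment k n.
Proof. by apply: Rintegral_ge0 => p; exact: log_density_fiber_int_ge0. Qed.

Lemma log_moment_le k n : log_moment k n <= log_moment k 0.
Proof.
apply: le_Rintegral => [//|||p /=]; try exact: integrable_log_density_fiber_int.
rewrite in_itv/= => /andP[p0 /ltW p1].
by rewrite ler_wpM2l ?log_density_ge0 ?fiber_int_le.
Qed.

Lemma sum_integral_J_integrand_log_moment n k :
  (\sum_(1 <= r < k) \int[lebesgue_tuple R k]_(u in unit_cube R k) (J_integrand n r u)%:E =
   (2^-1 * log_moment k.-1 n)%:E)%E.
Proof.
have ifib := integrable_log_density_fiber_int k.-1 n.
rewrite sum_integral_J_integrand_fiber EFinM fineK; last exact: integrable_fin_num ifib.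
rewrite -ge0_integralZl//.
- apply: eq_integral => p /set_mem/=; rewrite in_itv/= => /[dup] p01 /andP[p0 p1].
  by rewrite integral_J_kernel// -EFin_fiber_int// -!EFinM mulrCA.
- by case/integrableP: ifib.
- by move=> p; exact: log_density_fiber_int_ge0.
Qed.

Lemma integral_J_integrand_lty n r k : (1 <= r < k)%N ->
  (\int[lebesgue_tuple R k]_(u in unit_cube R k) (J_integrand n r u)%:E < +oo)%E.
Proof.
move=> rk; apply: (@le_lt_trans _ _ (2^-1 * log_moment k.-1 n)%:E); last exact: ltry.
rewrite -sum_integral_J_integrand_log_moment (bigD1_seq r) ?iota_uniq ?mem_index_iota//=.
rewrite leeDl// sume_ge0// => j _.
by apply: integral_ge0 => u cu; rewrite lee_fin J_integrand_ge0.
Qed.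

Lemma J_integrable n r k : (1 <= r < k)%N ->
  (lebesgue_tuple R k).-integrable (unit_cube R k) (fun u => (J_integrand n r u)%:E).
Proof.
move=> rk; apply/integrableP; split.
  by apply/measurable_funTS/measurable_EFinP; exact: measurable_J_integrand.
apply: le_lt_trans (integral_J_integrand_lty n rk).
rewrite le_eqVlt; apply/predU1l/eq_integral => u /set_mem cu.
by rewrite gee0_abs// lee_fin J_integrand_ge0.
Qed.

Lemma J_log_moment k n : (1 < k)%N -> J R k n = 2 ^+ k.-1 * log_moment k.-1 n.
Proof.
case: k => [|[|k]] // _; rewrite [J R k.+2 n]/J -big_distrr/= exprSr -mulrA; congr (_ * _).
apply: (mulfI (_ : 2^-1 != 0 :> R)); first by rewrite invr_eq0.
rewrite mulrA mulVf// mul1r.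
apply: EFin_inj; rewrite -(sum_integral_J_integrand_log_moment n k.+2) -sumEFin.
rewrite [LHS]big_seq [RHS]big_seq; apply: eq_bigr => r; rewrite mem_index_iota => rk.
rewrite -[RHS]fineK//; apply: integrable_fin_num (J_integrable n rk).
exact: measurable_unit_cube.
Qed.

End J_log_moment.

(** * The recurrence in n *)

Lemma integrable_EFinMl d (T : measurableType d) (R : realType) (mu : {measure set T -> \bar R})
    (D : set T) (f : T -> R) (c : R) : measurable D ->
  mu.-integrable D (EFin \o f) -> mu.-integrable D (EFin \o (fun x => c * f x)).
Proof. by move=> mD fi; have := integrableZl mD c fi; apply: eq_integrable. Qed.

Section apery_rec_integral.
Context d (T : measurableType d) (R : realType) (mu : {measure set T -> \bar R}).
Variables (D : set T) (f : nat -> T -> R) (n : nat).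
Hypotheses (mD : measurable D) (fi : forall i, mu.-integrable D (EFin \o f i)).

Let integrableZ (c : R) i : mu.-integrable D (EFin \o (fun x => c * f i x)).
Proof. exact: integrable_EFinMl. Qed.

Lemma integrable_apery_rec : mu.-integrable D (EFin \o (fun x => apery_rec (f ^~ x) n)).
Proof.
have := integrableD mD (integrableB mD (integrableZ (n.+1%:R ^+ 2) n.+1)
  (integrableZ (2 * n%:R ^+ 2 + 2 * n%:R + 3 / 4) n)) (integrableZ (n%:R ^+ 2) n.-1).
by apply: eq_integrable.
Qed.

Lemma Rintegral_apery_rec :
  \int[mu]_(x in D) apery_rec (f ^~ x) n = apery_rec (fun i => \int[mu]_(x in D) f i x) n.
Proof.
rewrite /apery_rec RintegralD//; last first.
  by have := integrableB mD (integrableZ (n.+1%:R ^+ 2) n.+1)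
    (integrableZ (2 * n%:R ^+ 2 + 2 * n%:R + 3 / 4) n); apply: eq_integrable.
by rewrite RintegralB// !RintegralZl.
Qed.

End apery_rec_integral.

Section primitives.
Context {R : realType}.
Implicit Types (p y : R) (k n : nat).

Definition root_kernel_d1 p y : R := (1 - p ^+ 4) * y ^+ 2 * root_kernel p y ^+ 3.

Definition root_kernel_d2 p y : R := (1 - 5 * p ^+ 4) * y ^+ 2 * root_kernel p y ^+ 3
  - 3 * (p * (1 - p ^+ 4) * y ^+ 2) * (4 * p - 2 * p * (1 - p ^+ 2) * y ^+ 2)
    * root_kernel p y ^+ 5.

Lemma root_kernelX_radicand m p y : 0 < p ->
  root_kernel p y ^+ m = root_kernel p y ^+ m.+2 * radicand p y.
Proof. by move=> p0; rewrite -addn2 exprD -mulrA root_kernelX2_radicand// mulr1. Qed.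

Lemma derives_mul_root_kernel p y : 0 < p ->
  derives (fun p => p * root_kernel p y) p (root_kernel_d1 p y).
Proof.
move=> p0; have droot := derives_root_kernel_p y p0; apply: derives_eq.
by rewrite mul1r -[X in X + _]expr1 root_kernelX_radicand// /root_kernel_d1 /radicand; ring.
Qed.

Lemma derives_mul_root_kernel_d1 p y : 0 < p ->
  derives (fun p => p * root_kernel_d1 p y) p (root_kernel_d2 p y).
Proof.
move=> p0; have droot := derives_root_kernel_p y p0; apply: derives_eq.
by rewrite /root_kernel_d1 /root_kernel_d2 /=; ring.
Qed.

(* Two integrations by parts in [ln p] at once. *)
Definition log_primitive k p y : R :=
  log_density k.+1 p * (p * root_kernel_d1 p y) + log_density k p * (p * root_kernel p y).

Lemma derives_log_primitive k p y : 0 < p ->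
  derives (log_primitive k ^~ y) p
    (log_density k.+1 p * root_kernel_d2 p y - log_density k.-1 p * root_kernel p y).
Proof.
move=> p0; have d1 := derives_log_density k.+1 p0; have d0 := derives_log_density k p0.
have dS := derives_mul_root_kernel y p0; have dS1 := derives_mul_root_kernel_d1 y p0.
by apply: derives_eq => /=; field; rewrite gt_eqF.
Qed.

Lemma log_density_at1 k : log_density k 1 = (k == 1%N)%:R :> R.
Proof.
by case: k => [|[|k]]; rewrite ?log_density1// /log_density ln1 oppr0 expr0n/= mul0r.
Qed.

Lemma log_primitive_at1 k y : log_primitive k 1 y = (k == 1%N)%:R / 2.
Proof.
rewrite /log_primitive /root_kernel_d1 expr1n subrr !(mul0r, mulr0, add0r, mul1r).
rewrite log_density_at1; congr (_ * _).
rewrite /root_kernel /radicand expr1n subrr expr0n/= mul0r addr0 mulr1.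
by rewrite (_ : 4 = 2 ^+ 2 :> R); [rewrite sqrtr_sqr ger0_norm|ring].
Qed.

Definition fiber_primitive n p y : R := beta_weight n y *
  (y * (- (n%:R / 2) * y ^+ 2 * root_kernel p y
    + (1 - y ^+ 2) * (p ^+ 2 + (1 - p ^+ 2) ^+ 2 * y ^+ 2 / 2) * root_kernel p y ^+ 3)).

(* The recurrence holds at the level of the integrands up to an exact derivative. *)
Lemma derives_fiber_primitive n p y : 0 < p ->
  derives (fiber_primitive n p) y
    (apery_rec (fun i => beta_weight i y * root_kernel p y) n
     - beta_weight n y * root_kernel_d2 p y / 4).
Proof.
move=> p0; have droot := derives_root_kernel_y y p0; have dbeta := derives_beta_weight n y.
apply: derives_eq; rewrite /apery_rec /root_kernel_d2 /=.
have S3 := root_kernelX_radicand 3 y p0.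
have S1 : root_kernel p y = root_kernel p y ^+ 5 * radicand p y ^+ 2.
  by rewrite expr2 mulrA -S3 -root_kernelX_radicand// expr1.
have S5 c : 3 * root_kernel p y ^+ 2 * (c * root_kernel p y ^+ 3) = 3 * c * root_kernel p y ^+ 5.
  by ring.
rewrite S5; move: S1 S3 {S5 droot}.
move: (root_kernel p y) (root_kernel p y ^+ 3) (root_kernel p y ^+ 5) => s1 s3 s5 -> ->.
rewrite /radicand; case: n dbeta => [|n] _; rewrite /beta_weight /=.
  by rewrite !expr0 !expr1; field.
rewrite -[n.+2%:R]natr1 -[n.+1%:R]natr1 !exprS.
by move: ((1 - y ^+ 2) ^+ n) (n%:R) => q N; field.
Qed.

Lemma fiber_primitive_edge n p y : y ^+ 2 = 1 -> fiber_primitive n p y = 0.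
Proof.
move=> y1; rewrite /fiber_primitive /beta_weight y1 subrr; case: n => [|n].
  by rewrite expr0; ring.
by rewrite exprS; ring.
Qed.

End primitives.

Section integral_limits.
Context {R : realType}.
Let mu := @lebesgue_measure R.

Lemma cvg_Rintegral_at_right (f : R -> R) (a b : R) : a < b ->
  mu.-integrable `]a, b[ (EFin \o f) ->
  \int[mu]_(x in `]e, b[) f x @[e --> a^'+] --> \int[mu]_(x in `]a, b[) f x.
Proof.
move=> ab fi; pose g := f \_ `]a, b[.
have mI : measurable (`]a, b[%classic : set (measurableTypeR R)) by exact: measurable_itv.
have gi : mu.-integrable setT (EFin \o g).
  by rewrite -restrict_EFin; apply/(integrable_mkcond _ mI).
have gi' (D : set R) : measurable D -> mu.-integrable D (EFin \o g).
  by move=> mD; exact: integrableS gi.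
have gE e : a <= e -> \int[mu]_(x in `]e, b[) f x = \int[mu]_(x in `]e, b]) g x.
  move=> ae; rewrite -Rintegral_itv_bndo_bndc; last exact: gi'.
  apply: eq_Rintegral => x /set_mem/=; rewrite in_itv/= => /andP[ex xb].
  by rewrite /g patchE mem_set//= in_itv/= (le_lt_trans ae ex).
have := @parameterized_integral_cvg_left R a b g ab (gi' _ (measurable_itv _)).
move=> /cvg_at_right_filter /(cvgB (cvg_cst (\int[mu]_(x in `[a, b]) g x))).
rewrite subr0 gE// (Rintegral_itv_obnd_cbnd (gi' _ (measurable_itv _))).
apply: cvg_trans; apply: near_eq_cvg; near=> e.
have ae : a <= e by near: e; exact: nbhs_right_ge.
have eb : e <= b by near: e; exact: nbhs_right_le.
rewrite gE// -(@Rintegral_itvB _ g (BLeft a) (BRight b) e)//; exact: gi'.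
Unshelve. all: by end_near. Qed.

Lemma mul_log_density_le1 k (x : R) : 0 < x <= 1 -> x * log_density k x <= 1.
Proof.
move=> /andP[x0 x1]; case: k => [|[|k]]; first by rewrite mulr0.
  by rewrite log_density1 mulr1.
have lnx0 : 0 <= - ln x by rewrite oppr_ge0 ln_le0.
have := expR_ge1Dxn k lnx0; rewrite expRN lnK ?posrE// => expR_ge.
rewrite mulrC -ler_pdivlMr// mul1r; apply: le_trans expR_ge.
by rewrite /log_density lerDr.
Qed.

(* Since [ln x = 2 ln (sqrt x)], one factor [sqrt x] is left over. *)
Lemma mul_log_density_le_sqrt k (x : R) : 0 < x <= 1 ->
  x * log_density k x <= 2 ^+ k * Num.sqrt x.
Proof.
move=> /andP[x0 x1]; have s0 : 0 < Num.sqrt x by rewrite sqrtr_gt0.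
have s1 : Num.sqrt x <= 1 by rewrite -sqrtr1 ler_wsqrtr.
have xE : x = Num.sqrt x ^+ 2 by rewrite sqr_sqrtr// ltW.
have -> : log_density k x = 2 ^+ k.-1 * log_density k (Num.sqrt x).
  case: k => [|k]; first by rewrite mulr0.
  by rewrite /log_density {1}xE lnXn// -mulNrn -[_ *+ 2]mulr_natl exprMn mulrA.
have := mul_log_density_le1 k (x := Num.sqrt x); rewrite s0 s1 => /(_ isT) le1.
rewrite {1}xE expr2 mulrACA; apply: (@le_trans _ _ (Num.sqrt x * 2 ^+ k.-1)).
  by rewrite ler_piMr// mulr_ge0 ?exprn_ge0// ltW.
by rewrite mulrC ler_wpM2r ?(ltW s0)// ler_weXn2l ?leq_pred// ler1n.
Qed.

Lemma cvg_mul_log_density k : x * log_density k x @[x --> (0 : R)^'+] --> (0 : R).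
Proof.
apply: (@squeeze_cvgr _ _ _ _ (fun=> 0) (fun x : R => 2 ^+ k * Num.sqrt x)).
- near=> x; have x01 : 0 < x <= 1.
    by apply/andP; split; near: x; [exact: nbhs_right_gt|exact: nbhs_right_le].
  have /andP[x0 x1] := x01.
  by rewrite mul_log_density_le_sqrt// mulr_ge0 ?log_density_ge0// ltW.
- exact: cvg_cst.
- rewrite [X in _ --> X](_ : 0 = 2 ^+ k * Num.sqrt 0); last by rewrite sqrtr0 mulr0.
  apply: cvgMr.
  by apply: cvg_at_right_filter; exact: sqrt_continuous.
Unshelve. all: by end_near. Qed.

End integral_limits.

Section fiber_recurrence.
Context {R : realType}.
Implicit Types (p y : R) (n : nat).
Let mu := @lebesgue_measure R.

Lemma continuous_beta_weight n : continuous (@beta_weight R n).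
Proof. by move=> y; have db := derives_beta_weight n y; exact: derives_continuous. Qed.

Lemma integrable_beta_weight_root_kernel_d2 n p : 0 < p ->
  mu.-integrable `[(-1), 1] (EFin \o (fun y => beta_weight n y * root_kernel_d2 p y)).
Proof.
move=> p0; apply: integrable_segment => y.
have db := derives_beta_weight n y; have dr := derives_root_kernel_y y p0.
exact: derives_continuous.
Qed.

Lemma apery_rec_fiber_int n p : 0 < p ->
  apery_rec (fiber_int ^~ p) n =
  4^-1 * \int[mu]_(y in `[(-1), 1]) (beta_weight n y * root_kernel_d2 p y).
Proof.
move=> p0; have mI : measurable (`[(-1), 1]%classic : set (measurableTypeR R)).
  exact: measurable_itv.
have ibeta i := integrable_fiber_integrand i p0.
have id2 := integrable_beta_weight_root_kernel_d2 n p0.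
pose f y := apery_rec (fun i => beta_weight i y * root_kernel p y) n
  - 4^-1 * (beta_weight n y * root_kernel_d2 p y).
have cf : {in `[(-1), 1], continuous f}.
  move=> y _; have dr := derives_root_kernel_y y p0.
  have db i := derives_beta_weight i y; exact: derives_continuous.
have lt_m11 : -1 < 1 :> R by lra.
have df y : -1 <= y <= 1 -> derives (fiber_primitive n p) y (f y).
  by move=> _; apply: derives_eq (derives_fiber_primitive n y p0) _; rewrite /f [in RHS]mulrC.
have /(congr1 fine) := derives_FTC2 lt_m11 cf df.
rewrite !fiber_primitive_edge ?sqrrN ?expr1n// subrr /=.
rewrite -[LHS]/(\int[mu]_(y in `[(-1), 1]) f y) RintegralB//; last 2 first.
- exact: (integrable_apery_rec n mI ibeta).
- exact: integrable_EFinMl.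
by rewrite Rintegral_apery_rec// RintegralZl// => /eqP; rewrite subr_eq0 => /eqP.
Qed.

End fiber_recurrence.

Section integrable_rectangle.
Context {R : realType}.
Let mu := @lebesgue_measure R.

Lemma continuous_rectangle_integrable (f : R * R -> R) (a b c d : R) :
  measurable_fun setT f ->
  (forall z, `[a, b]%classic z.1 -> `[c, d]%classic z.2 -> {for z, continuous f}) ->
  (mu \x mu)%E.-integrable (`[a, b]%classic `*` `[c, d]%classic) (EFin \o f).
Proof.
move=> mf cf; have mrect : measurable (`[a, b]%classic `*` `[c, d]%classic : set (R * R)).
  by apply: (@measurableX _ _ (measurableTypeR R) (measurableTypeR R)); exact: measurable_itv.
have fin_segment (u v : R) : mu `[u, v]%classic \is a fin_num.
  by rewrite ge0_fin_numE// compact_finite_measure//; exact: segment_compact.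
apply: measurable_bounded_integrable => //.
- by rewrite [ltLHS]product_measure1E// ltey_eq fin_numM.
- exact: measurable_funTS.
have rect_compact : compact (`[a, b]%classic `*` `[c, d]%classic).
  by apply: compact_setX; exact: segment_compact.
have /(_ _)/compact_bounded := @continuous_compact _ _ (f : R * R -> R^o) _ _ rect_compact.
case=> [|M [Mreal fM]].
  by apply: continuous_in_subspaceT => z /set_mem[]; exact: cf.
by exists M; split=> // N /fM fN z rz /=; apply: fN; exists z.
Qed.

End integrable_rectangle.

Section parts_integrand.
Context {R : realType}.
Implicit Types (p y : R) (k n : nat).

Definition parts_integrand k n p y : R := beta_weight n y *
  (log_density k.+1 p * root_kernel_d2 p y - log_density k.-1 p * root_kernel p y).

Lemma measurable_parts_integrand d (T : measurableType d) (f g : T -> R) k n :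
  measurable_fun setT f -> measurable_fun setT g ->
  measurable_fun setT (fun z => parts_integrand k n (f z) (g z)).
Proof.
move=> mf mg; have mk := measurable_root_kernel mf mg.
have ml i := measurable_log_density i mf; rewrite /parts_integrand /root_kernel_d2.
by repeat first [exact: mf | exact: mg | exact: mk | exact: ml | measurable_step].
Qed.

End parts_integrand.

Section tends.
Context {R : realType} {T : Type} (F : set_system T) {FF : Filter F}.
Implicit Types (f g : T -> R) (l m p y : R) (k n : nat).

Definition tends f l : Prop := f x @[x --> F] --> l.
Existing Class tends.

#[local] Instance tends_cst l : tends (fun=> l) l.
Proof. exact: cvg_cst. Qed.

#[local] Instance tendsN f l : tends f l -> tends (fun x => - f x) (- l).
Proof. exact: cvgN. Qed.

#[local] Instance tendsD f g l m : tends f l -> tends g m -> tends (fun x => f x + g x) (l + m).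
Proof. exact: cvgD. Qed.

#[local] Instance tendsM f g l m : tends f l -> tends g m -> tends (fun x => f x * g x) (l * m).
Proof. exact: cvgM. Qed.

#[local] Instance tendsX f l n : tends f l -> tends (fun x => f x ^+ n) (l ^+ n).
Proof. by move=> fl; exact: continuous_cvg (@exprn_continuous R n l) fl. Qed.

Lemma tends_parts_integrand f g k n p y : 0 < p -> tends f p -> tends g y ->
  tends (fun x => parts_integrand k n (f x) (g x)) (parts_integrand k n p y).
Proof.
move=> p0 fp gy.
have cl i : tends (fun x => log_density i (f x)) (log_density i p).
  by apply: continuous_cvg fp; exact: continuous_log_density.
have crad : tends (fun x => radicand (f x) (g x)) (radicand p y) by apply _.
have ck : tends (fun x => root_kernel (f x) (g x)) (root_kernel p y).
  apply: cvgV; first by rewrite gt_eqF// sqrtr_gt0 radicand_gt0.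
  exact: continuous_cvg (@sqrt_continuous _ _) crad.
by rewrite /parts_integrand /root_kernel_d2 /beta_weight; apply _.
Qed.

End tends.

Section integration_by_parts.
Context {R : realType}.
Implicit Types (p e y : R) (k n : nat).
Let mu := @lebesgue_measure R.

Lemma integrable_parts_integrand k n e : 0 < e ->
  (mu \x mu)%E.-integrable (`]e, 1[%classic `*` `[(-1), 1]%classic)
    (fun z => (parts_integrand k n z.1 z.2)%:E).
Proof.
move=> e0; pose f (z : R * R) := parts_integrand k n z.1 z.2.
have : (mu \x mu)%E.-integrable (`[e, 1]%classic `*` `[(-1), 1]%classic) (EFin \o f).
  apply: continuous_rectangle_integrable => [|z].
    by apply: measurable_parts_integrand; [exact: measurable_fst|exact: measurable_snd].
  rewrite /= in_itv/= => /andP[ez _] _.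
  exact: tends_parts_integrand (lt_le_trans e0 ez) cvg_fst cvg_snd.
apply: integrableS.
- exact: (@measurableX _ _ (measurableTypeR R) (measurableTypeR R) `[e, 1] `[(-1), 1]).
- exact: (@measurableX _ _ (measurableTypeR R) (measurableTypeR R) `]e, 1[ `[(-1), 1]).
- by move=> z [ez Iz]; split=> //; exact: subset_itv_oo_cc ez.
Qed.

Lemma integral_parts_integrand_y k n p : 0 < p ->
  (\int[mu]_(y in `[(-1)%R, 1%R]) (parts_integrand k n p y)%:E =
   (4 * (log_density k.+1 p * apery_rec (fiber_int ^~ p) n)
    - log_density k.-1 p * fiber_int n p)%:E)%E.
Proof.
move=> p0; have mI : measurable (`[(-1), 1]%classic : set (measurableTypeR R)).
  exact: measurable_itv.
have iparts : mu.-integrable `[(-1), 1] (EFin \o parts_integrand k n p).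
  apply: integrable_segment => y.
  have dbeta := derives_beta_weight n y; have droot := derives_root_kernel_y y p0.
  exact: derives_continuous.
rewrite -[LHS]fineK; last exact: integrable_fin_num iparts.
have ibeta := integrable_fiber_integrand n p0.
have id2 := integrable_beta_weight_root_kernel_d2 n p0.
congr EFin; rewrite apery_rec_fiber_int// mulrCA [4 * _]mulrA mulfV// mul1r.
rewrite /fiber_int -!RintegralZl// -RintegralB//.
- by apply: eq_Rintegral => y _; rewrite /parts_integrand; ring.
- exact: integrable_EFinMl.
- exact: integrable_EFinMl.
Qed.

Lemma integral_parts_integrand_p k n e y : 0 < e < 1 ->
  (\int[mu]_(p in `]e, 1%R[) (parts_integrand k n p y)%:E =
   (beta_weight n y * (log_primitive k 1 y - log_primitive k e y))%:E)%E.
Proof.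
move=> /andP[e0 e1]; have pos p : e <= p <= 1 -> 0 < p.
  by move=> /andP[ep _]; exact: lt_le_trans ep.
rewrite -(@integral_itv_bndoo _ e 1 _ true false); last first.
  apply/measurable_funTS/measurable_EFinP/measurable_parts_integrand; first exact: measurable_id.
  exact: measurable_cst.
have cont : {in `[e, 1], continuous (parts_integrand k n ^~ y)}.
  move=> p; rewrite in_itv/= => /pos p0; apply: tends_parts_integrand p0 cvg_id _.
  exact: cvg_cst.
have dF p : e <= p <= 1 ->
    derives (fun p => beta_weight n y * log_primitive k p y) p (parts_integrand k n p y).
  move=> /pos p0; have dlog := derives_log_primitive k y p0.
  by apply: derives_eq; rewrite /parts_integrand; ring.
by rewrite (derives_FTC2 e1 cont dF) mulrBr.
Qed.

Lemma Rintegral_parts_integrand k n e : 0 < e < 1 ->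
  \int[mu]_(p in `]e, 1[) (4 * (log_density k.+1 p * apery_rec (fiber_int ^~ p) n)
     - log_density k.-1 p * fiber_int n p) =
  \int[mu]_(y in `[(-1), 1]) (beta_weight n y * (log_primitive k 1 y - log_primitive k e y)).
Proof.
move=> e01; have /andP[e0 _] := e01; rewrite /Rintegral; congr fine.
transitivity (\int[mu]_(p in `]e, 1%R[) \int[mu]_(y in `[(-1)%R, 1%R])
    (parts_integrand k n p y)%:E)%E.
  apply: eq_integral => p /set_mem/=; rewrite in_itv/= => /andP[ep _].
  by rewrite integral_parts_integrand_y// (lt_trans e0).
transitivity (\int[mu]_(y in `[(-1)%R, 1%R]) \int[mu]_(p in `]e, 1%R[)
    (parts_integrand k n p y)%:E)%E.
  apply: (@fubini_region _ _ (measurableTypeR R) (measurableTypeR R) R mu mu `]e, 1[%classic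
    (fun=> `[(-1), 1]%classic) `[(-1), 1]%classic (fun=> `]e, 1[%classic)
    (fun z => (parts_integrand k n z.1 z.2)%:E)).
  - by move=> p y; split=> -[].
  - exact: (@measurableX _ _ (measurableTypeR R) (measurableTypeR R) `]e, 1[ `[(-1), 1]).
  - exact: integrable_parts_integrand.
by apply: eq_integral => y _; exact: integral_parts_integrand_p.
Qed.

End integration_by_parts.

Section log_moment_recurrence.
Context {R : realType}.
Implicit Types (p e y : R) (k n : nat).
Let mu := @lebesgue_measure R.

Let mI : measurable (`[(-1), 1]%classic : set (measurableTypeR R)).
Proof. exact: measurable_itv. Qed.

Lemma root_kernel_d1_itv p y : 0 < p <= 1 -> `[(-1), 1]%classic y ->
  0 <= root_kernel_d1 p y <= root_kernel p y.
Proof.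
move=> /andP[p0 p1] Iy; have s30 : 0 <= root_kernel p y ^+ 3.
  by rewrite exprn_ge0// ltW// root_kernel_gt0.
have y1 : y ^+ 2 <= 1 by have := beta_weight_ge0 1 Iy; rewrite /beta_weight expr1 subr_ge0.
have p4 : p ^+ 4 <= 1 by rewrite exprn_ile1// ltW.
have c0 : 0 <= (1 - p ^+ 4) * y ^+ 2 by rewrite mulr_ge0 ?sqr_ge0// subr_ge0.
rewrite /root_kernel_d1 (mulr_ge0 c0 s30)/=.
rewrite -[leRHS]expr1 [leRHS]root_kernelX_radicand// mulrC ler_wpM2l// -subr_ge0.
have -> : radicand p y - (1 - p ^+ 4) * y ^+ 2 =
    2 * p ^+ 2 * (1 + (1 - y ^+ 2) + p ^+ 2 * y ^+ 2) by rewrite /radicand; ring.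
have yC0 : 0 <= 1 - y ^+ 2 by rewrite subr_ge0.
have py0 : 0 <= p ^+ 2 * y ^+ 2 by rewrite mulr_ge0 ?sqr_ge0.
by apply: mulr_ge0; [rewrite mulr_ge0 ?sqr_ge0|apply: addr_ge0 => //; exact: addr_ge0].
Qed.

Lemma log_primitive_itv k p y : 0 < p <= 1 -> `[(-1), 1]%classic y ->
  0 <= log_primitive k p y <= (log_density k.+1 p + log_density k p) * p * root_kernel p y.
Proof.
move=> p01 Iy; have /andP[p0 p1] := p01; have /andP[d1_ge0 d1_le] := root_kernel_d1_itv p01 Iy.
have s0 := root_kernel_gt0 y p0; have ld0 i : 0 <= log_density i p by exact: log_density_ge0.
have pd1_ge0 : 0 <= p * root_kernel_d1 p y := mulr_ge0 (ltW p0) d1_ge0.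
have ps_ge0 : 0 <= p * root_kernel p y := mulr_ge0 (ltW p0) (ltW s0).
rewrite /log_primitive (addr_ge0 (mulr_ge0 (ld0 _) pd1_ge0) (mulr_ge0 (ld0 _) ps_ge0))/=.
by rewrite -mulrA mulrDl lerD2r; apply: ler_wpM2l => //; apply: ler_wpM2l => //; exact: ltW.
Qed.

Lemma integrable_beta_weight n : mu.-integrable `[(-1), 1] (EFin \o beta_weight n).
Proof. by apply: integrable_segment; exact: continuous_beta_weight. Qed.

Lemma integrable_beta_weight_log_primitive k n p : 0 < p ->
  mu.-integrable `[(-1), 1] (EFin \o (fun y => beta_weight n y * log_primitive k p y)).
Proof.
move=> p0; apply: integrable_segment => y.
have db := derives_beta_weight n y; have dr := derives_root_kernel_y y p0.
exact: derives_continuous.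
Qed.

Definition boundary_term k n p : R :=
  \int[mu]_(y in `[(-1), 1]) (beta_weight n y * log_primitive k p y).

Lemma boundary_term_ge0 k n p : 0 < p <= 1 -> 0 <= boundary_term k n p.
Proof.
move=> p01; apply: Rintegral_ge0 => y Iy; rewrite mulr_ge0 ?beta_weight_ge0//.
by have /andP[] := log_primitive_itv k p01 Iy.
Qed.

Lemma boundary_term_le k n p : 0 < p < 1 -> boundary_term k n p <=
  2 * (p * log_density k.+1 p + k.+1%:R * (p * log_density k.+2 p)
       + p * log_density k p + k%:R * (p * log_density k.+1 p)).
Proof.
move=> p01; have /andP[p0 /ltW p1] := p01.
have p01W : 0 < p <= 1 by rewrite p0.
pose c := (log_density k.+1 p + log_density k p) * p.
have c0 : 0 <= c by rewrite mulr_ge0 ?addr_ge0 ?log_density_ge0// ltW.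
have ibeta := integrable_fiber_integrand n p0.
apply: (@le_trans _ _ (c * fiber_int n p)).
  rewrite -RintegralZl//; apply: le_Rintegral => //.
  - exact: integrable_beta_weight_log_primitive.
  - exact: integrable_EFinMl.
  - move=> y Iy; rewrite mulrCA ler_wpM2l ?beta_weight_ge0//.
    by have /andP[] := log_primitive_itv k p01W Iy.
apply: le_trans (ler_wpM2l c0 (fiber_int_le_log n p01)) _.
have log2 i : p * log_density i p * log_density 2 p = i%:R * (p * log_density i.+1 p).
  by rewrite -mulrA log_density_mul2 mulrCA.
by rewrite -!log2 /c; lra.
Qed.

Lemma cvg_boundary_term k n : boundary_term k n p @[p --> (0 : R)^'+] --> (0 : R).
Proof.
have clog i := @cvg_mul_log_density R i.
apply: (@squeeze_cvgr _ _ _ _ (fun=> 0) (fun p : R => 2 * (p * log_density k.+1 p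
  + k.+1%:R * (p * log_density k.+2 p) + p * log_density k p + k%:R * (p * log_density k.+1 p)))).
- near=> p; have p01 : 0 < p < 1.
    by apply/andP; split; near: p; [exact: nbhs_right_gt|exact: nbhs_right_lt].
  rewrite boundary_term_le// boundary_term_ge0//.
  by have /andP[-> /ltW ->] := p01.
- exact: cvg_cst.
- rewrite [X in _ --> X](_ : 0 = 2 * (0 + k.+1%:R * 0 + 0 + k%:R * 0)); last by ring.
  apply: cvgMr; apply: cvgD; last by apply: cvgMr; exact: clog.
  by apply: cvgD; last exact: clog; apply: cvgD; last apply: cvgMr; exact: clog.
Unshelve. all: by end_near. Qed.

Definition beta_int n : R := \int[mu]_(y in `[(-1), 1]) beta_weight n y.

Lemma Rintegral_parts_boundary_term k n e : 0 < e < 1 ->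
  \int[mu]_(p in `]e, 1[) (4 * (log_density k.+1 p * apery_rec (fiber_int ^~ p) n)
     - log_density k.-1 p * fiber_int n p) =
  (k == 1%N)%:R / 2 * beta_int n - boundary_term k n e.
Proof.
move=> e01; have /andP[e0 _] := e01; rewrite Rintegral_parts_integrand//.
rewrite -RintegralZl//; last exact: integrable_beta_weight.
rewrite -RintegralB//; last 2 first.
- by apply: integrable_EFinMl => //; exact: integrable_beta_weight.
- exact: integrable_beta_weight_log_primitive.
by apply: eq_Rintegral => y _; rewrite log_primitive_at1; ring.
Qed.

Lemma apery_rec_log_moment k n : 4 * apery_rec (log_moment k.+1) n =
  log_moment k.-1 n + (k == 1%N)%:R / 2 * beta_int n.
Proof.
have mU : measurable (`]0, 1[%classic : set (measurableTypeR R)) by exact: measurable_itv.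
pose f p := apery_rec (fun i => log_density k.+1 p * fiber_int i p) n.
pose g p := log_density k.-1 p * fiber_int n p.
have ilog i := @integrable_log_density_fiber_int R k.+1 i.
have i4f : mu.-integrable `]0, 1[ (EFin \o (fun p => 4 * f p)).
  exact: integrable_EFinMl (integrable_apery_rec n mU ilog).
have ig : mu.-integrable `]0, 1[ (EFin \o g) by exact: integrable_log_density_fiber_int.
have ifg : mu.-integrable `]0, 1[ (EFin \o (fun p => 4 * f p - g p)).
  by have := integrableB mU i4f ig; apply: eq_integrable.
have limE : \int[mu]_(p in `]0, 1[) (4 * f p - g p) =
    4 * apery_rec (log_moment k.+1) n - log_moment k.-1 n.
  rewrite RintegralB// RintegralZl//; last exact: integrable_apery_rec.
  by rewrite Rintegral_apery_rec.
suff lim : \int[mu]_(p in `]e, 1[) (4 * f p - g p) @[e --> 0^'+] -->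
    (k == 1%N)%:R / 2 * beta_int n - 0.
  have := cvg_unique _ (cvg_Rintegral_at_right ltr01 ifg) lim.
  by rewrite limE subr0 => <- //; rewrite addrC subrK.
apply: cvg_trans (cvgB (cvg_cst _) (cvg_boundary_term k n)).
apply: near_eq_cvg; near=> e; have e01 : 0 < e < 1.
  by apply/andP; split; near: e; [exact: nbhs_right_gt|exact: nbhs_right_lt].
rewrite -[LHS](Rintegral_parts_boundary_term k n e01).
by apply: eq_Rintegral => p _; rewrite /f /g /apery_rec; ring.
Unshelve. all: by end_near. Qed.

End log_moment_recurrence.

Section J_recurrence.
Context {R : realType}.
Implicit Types (k n : nat).
Let mu := @lebesgue_measure R.

Lemma beta_intS n : (2 * n.+1 + 1)%:R * beta_int n.+1 = (2 * n.+1)%:R * beta_int n :> R.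
Proof.
have mI : measurable (`[(-1), 1]%classic : set (measurableTypeR R)) by exact: measurable_itv.
have integrableZ (c : R) i : mu.-integrable `[(-1), 1] (EFin \o (fun y => c * beta_weight i y)).
  by apply: integrable_EFinMl => //; exact: integrable_beta_weight.
pose f y : R := (2 * n.+1 + 1)%:R * beta_weight n.+1 y - (2 * n.+1)%:R * beta_weight n y.
have cf : {in `[(-1), 1], continuous f}.
  by move=> y _; have db i := derives_beta_weight i y; exact: derives_continuous.
have df y : -1 <= y <= 1 -> derives (fun y => y * beta_weight n.+1 y) y (f y).
  move=> _; have db := derives_beta_weight n.+1 y; apply: derives_eq.
  by rewrite /f /beta_weight/= exprS !natrD !natrM; ring.
have lt_m11 : -1 < 1 :> R by lra.
have /(congr1 fine) := derives_FTC2 lt_m11 cf df.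
rewrite /beta_weight sqrrN !expr1n subrr expr0n !mulr0 subrr/=.
rewrite -[LHS]/(\int[mu]_(y in `[(-1), 1]) f y) RintegralB//.
by rewrite !RintegralZl ?integrable_beta_weight// => /eqP; rewrite subr_eq0 => /eqP.
Qed.

Lemma beta_int_J1 n : beta_int n = 2 * J R 1 n.
Proof.
rewrite /J; elim: n => [|n ih].
  rewrite /beta_int; under eq_Rintegral do rewrite /beta_weight expr0.
  rewrite Rintegral_cst//= [lebesgue_measure _]lebesgue_measure_itv/=.
  rewrite lte_fin (_ : -1 < 1 :> R) ?opprK/=; last by lra.
  by rewrite /odd_dfact big_ord1 expn0 fact0 muln0 add0n /=; field.
have odd_neq0 : (2 * n.+1 + 1)%:R != 0 :> R by rewrite addn1 pnatr_eq0.
have dfact_neq0 : (odd_dfact n)%:R != 0 :> R.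
  by rewrite pnatr_eq0 -lt0n; apply: prodn_gt0 => i; rewrite addn1.
apply: (mulfI odd_neq0); rewrite beta_intS ih.
rewrite [odd_dfact n.+1]big_ord_recr -/(odd_dfact n) factS expnS !natrM.
move: (2 * n.+1 + 1)%:R odd_neq0 (odd_dfact n)%:R dfact_neq0 => c c0 d d0.
by field; rewrite d0 c0.
Qed.

Theorem apery_rec_J k n : (1 < k)%N -> apery_rec (J R k) n = J R (k - 2) n.
Proof.
case: k => [|[|k]] // _; rewrite !subSS subn0.
have -> : J R k.+2 = fun i => 2 ^+ k.+1 * log_moment k.+1 i.
  by apply/funext => i; exact: J_log_moment.
have := @apery_rec_log_moment R k n; rewrite apery_recZ beta_int_J1.
case: k => [|[|k]].
- by rewrite /= log_moment0 expr1; lra.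
- by rewrite /= log_moment0 expr2; lra.
- by rewrite (@J_log_moment _ k.+2 n)//= mul0r mul0r addr0 => <-; rewrite 2!exprS; ring.
Qed.

Lemma J_norm_le k n : (1 < k)%N -> `|J R k n| <= J R k 0.
Proof.
have c0 : 0 <= 2 ^+ k.-1 :> R by exact: exprn_ge0.
move=> k1; rewrite !J_log_moment// ger0_norm; last exact: mulr_ge0 c0 (log_moment_ge0 _ _).
by rewrite ler_wpM2l// log_moment_le.
Qed.

Lemma radius_ge1_J k : (1 < k)%N -> radius_ge1 (fun n => RtoC (J R k n)).
Proof.
move=> k1; apply: (@bounded_radius_ge1 _ _ (RtoC (J R k 0))) => n.
by rewrite normc_def/= expr0n/= addr0 sqrtr_sqr lecR J_norm_le.
Qed.

End J_recurrence.

Unset Implicit Arguments.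

Theorem theorem3p5 (R : realType) (k : nat) (hk : (2 <= k)%N) :
  (forall n r : nat, (1 <= r < k)%N ->
     (lebesgue_tuple R k).-integrable (unit_cube R k)
       (fun u => (J_integrand n r u)%:E)) /\
  (forall z : Cplx R, `|z| < 1 ->
     [/\ cvgn (series (w_term R k z)),
         cvgn (series (w_term R (k - 2) z)),
         derivable (w R k) z 1,
         derivable (derive1 (w R k)) z 1 &
         z * (1 - z) ^+ 2 * derive1 (derive1 (w R k)) z
           + (1 - z) * (1 - 3 * z) * derive1 (w R k) z
           + (z - 3 / 4) * w R k z
         = w R (k - 2) z]).
Proof.
split=> [n r rk|z z1]; first exact: J_integrable.
have := power_sum_apery_rec_ode (radius_ge1_J hk) z1.
suff -> : apery_rec (fun n => RtoC (J R k n)) = fun n => RtoC (J R (k - 2) n) by [].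
by apply/funext => n; rewrite -(rmorph_apery_rec (real_complex R)) apery_rec_J.
Qed.
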